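(* Let $X=(X_n:n\ge 0)$ be an $S$-valued Markov chain with one-step transition kernel $P$ having a unique stationary distribution $\pi$, and let $f:S\to\mathbb{R}_+$ be a non-negative measurable function. Suppose there exist a non-empty (measurable) subset $C\subset S$, non-negative measurable functions $v_1,v_2:S\to\mathbb{R}_+$, a probability measure $\varphi$ on $S$, an integer $m\ge 1$, and positive constants $\lambda,b_1,b_2$ such that (i) $(Pv_1)(x)\le v_1(x)-f(x)+b_1\mathbb{I}_C(x)$ for all $x\in S$; (ii) $(Pv_2)(x)\le v_2(x)-1+b_2\mathbb{I}_C(x)$ for all $x\in S$; (iii) $\mathbb{P}_x(X_m\in\cdot)\ge\lambda\varphi(\cdot)$ for all $x\in C$. Let $\tau$ be the randomized stopping time constructed from $C,m,\lambda,\varphi$ as described in the context, let $f_c=f-\pi f$, and let $g^*(x)=\mathbb{E}_x\sum_{j=0}^{\tau-1}f_c(X_j)$ for $x\in S$. Then $g^*$ is a solution of Poisson's equation for $f_c$ (that is, $\int_S|g^*(y)|P(x,dy)<\infty$ for every $x\in S$ and $(P-I)g^*=-f_c$), and for every $x\in S$, $$-b_1\left(v_2(x)+\frac{b_2m}{\lambda}\right)\le g^*(x)\le v_1(x)+\frac{b_1m}{\lambda}$$ and $$|g^*(x)|\le\max\left\{v_1(x)+\frac{b_1m}{\lambda},\; b_1\left(v_2(x)+\frac{b_2m}{\lambda}\right)\right\}.$$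
   Context: Notation. $(Ph)(x)=\int_S h(y)P(x,dy)$; $\mu h=\int_S h\,d\mu$; $I$ is the identity operator; $\mathbb{I}_C$ is the indicator function of $C$; $\mathbb{P}_x(\cdot)=\mathbb{P}(\cdot\mid X_0=x)$ with expectation $\mathbb{E}_x$; $\mathbb{P}_\mu=\int_S\mu(dx)\mathbb{P}_x$ with expectation $\mathbb{E}_\mu$. Under hypotheses (i)-(iii), $\pi f\le b_1<\infty$, so $f_c$ is well defined, and the expectation defining $g^*$ is finite. Construction of $\tau$. By (iii), for $x\in C$ one can write $\mathbb{P}_x(X_m\in\cdot)=\lambda\varphi(\cdot)+(1-\lambda)Q(x,\cdot)$, which defines the probability $Q(x,\cdot)$ (arbitrary if $\lambda=1$). Let $R(x,y,\cdot)=\mathbb{P}_x((X_1,\dots,X_{m-1})\in\cdot\mid X_m=y)$ be the (regular) conditional distribution of the intermediate states given the endpoint; it is assumed to exist, as is the case for instance if $S$ is a standard Borel space, and it is not needed if $m=1$. Let $T_1=\inf\{n\ge 0:X_n\in C\}$ and $T_{i+1}=\inf\{n\ge T_i+m:X_n\in C\}$ for $i\ge 1$. The path of $X$ is generated as follows. From the initial state, run $X$ with kernel $P$ until time $T_1$. At each time $T_i$, generate a Bernoulli($\lambda$) random variable $B_{T_i}$ independently of everything generated so far; draw $X_{T_i+m}$ from $\varphi$ if $B_{T_i}=1$ and from $Q(X_{T_i},\cdot)$ if $B_{T_i}=0$; draw $(X_{T_i+1},\dots,X_{T_i+m-1})$ from $R(X_{T_i},X_{T_i+m},\cdot)$; then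 run $X$ with kernel $P$ from time $T_i+m$ until time $T_{i+1}$. This preserves the law of the Markov chain $X$ with kernel $P$. Put $\beta=\inf\{n\ge 1:B_{T_n}=1\}$ and $\tau=T_\beta+m$. The same construction is used for every initial distribution of $X_0$, and $\mathbb{P}_x,\mathbb{E}_x,\mathbb{P}_\mu,\mathbb{E}_\mu$ refer to this enlarged probability space. *)

(* Defs.v *)
From HB Require Import structures.
From mathcomp Require Import all_boot all_order all_algebra.
From mathcomp Require Import all_classical all_reals all_analysis.

Set Implicit Arguments.
Unset Strict Implicit.
Unset Printing Implicit Defensive.
Import Order.TTheory GRing.Theory Num.Theory.
Import numFieldNormedType.Exports.

Local Open Scope classical_set_scope.
Local Open Scope ring_scope.

Definition stationary d (S : measurableType d) (R : realType)
    (P : R.-pker S ~> S) (mu : probability S R) : Prop :=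
  forall A, measurable A -> (\int[mu]_x P x A = mu A)%E.

(* The [n]-step kernel P^n; P^0 is the identity kernel. *)
Fixpoint kernel_iter d (S : measurableType d) (R : realType)
    (P : R.-pker S ~> S) (n : nat) : R.-spker S ~> S :=
  match n with
  | 0%N => kdirac (measurable_id (D := setT))
  | k.+1 => mkcomp_noparam P (kernel_iter P k)
  end.

(* Finite-dimensional laws of the chain with kernel [P]:
   [path_prob P n x D E] = P_x((X_1, ..., X_n) \in D, X_{n+1} \in E). *)
Fixpoint path_prob d (S : measurableType d) (R : realType)
    (P : R.-pker S ~> S) (n : nat) :
    S -> set (n.-tuple S) -> set S -> \bar R :=
  match n return S -> set (n.-tuple S) -> set S -> \bar R with
  | 0%N => fun x D E => ((\1_D [tuple])%:E * P x E)%E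
  | k.+1 => fun x D E =>
      (\int[P x]_y path_prob P y [set t : k.-tuple S | D [tuple of y :: t]] E)%E
  end.

(* [Q] is the residual kernel on [C]: P_x(X_m \in .) = lam phi + (1 - lam) Q(x, .).
   When [lam = 1] this leaves [Q] arbitrary. *)
Definition residual_kernel d (S : measurableType d) (R : realType)
    (P : R.-pker S ~> S) (C : set S) (m : nat) (lam : R)
    (phi : probability S R) (Q : R.-pker S ~> S) : Prop :=
  forall x A, C x -> measurable A ->
    kernel_iter P m x A = (lam%:E * phi A + (1 - lam)%:E * Q x A)%E.

(* [Br (x, y)] is a regular conditional distribution of (X_1, ..., X_{m-1})
   given X_m = y under P_x, for x in [C]. *)
Definition bridge_kernel d (S : measurableType d) (R : realType)
    (P : R.-pker S ~> S) (C : set S) (m : nat)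
    (Br : R.-pker (S * S) ~> (m.-1.-tuple S)) : Prop :=
  forall x D E, C x -> measurable D -> measurable E ->
    path_prob P x D E = (\int[kernel_iter P m x]_(y in E) Br (x, y) D)%E.

(* Infimum of a set of times; [None] stands for the infinite time. *)
Definition first_time (p : nat -> Prop) : option nat :=
  match pselect (exists n, `[< p n >]) with
  | left h => Some (ex_minn h)
  | right _ => None
  end.

Section split_times.
Context {S : Type}.
Variables (C : set S) (m : nat).

(* Indices start from 0: [entry_time w i] is T_{i+1} along the path [w]. *)
Fixpoint entry_time (w : nat -> S) (i : nat) : option nat :=
  match i with
  | 0%N => first_time (fun n => C (w n))
  | j.+1 => if entry_time w j is Some t
            then first_time (fun n => (t + m <= n)%N /\ C (w n))
            else None
  end.

(* Also indexed from 0: this is beta - 1. The coin tossed at time [t] is [b t],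
   and only the coins tossed at entry times matter. *)
Definition success_index (w : nat -> S) (b : nat -> bool) : option nat :=
  first_time (fun i => exists2 t, entry_time w i = Some t & b t).

Definition split_tau (w : nat -> S) (b : nat -> bool) : option nat :=
  if success_index w b is Some i
  then omap (fun t => (t + m)%N) (entry_time w i)
  else None.

Definition is_entry_time (w : nat -> S) (n : nat) : Prop :=
  exists i, entry_time w i = Some n.

Definition time_lt (n : nat) (o : option nat) : Prop :=
  if o is Some t then (n < t)%N else True.

(* n < T_1, or T_i + m <= n < T_{i+1} for some i: the times at which the next
   state is drawn from P. *)
Definition running (w : nat -> S) (n : nat) : Prop :=
  time_lt n (entry_time w 0) \/
  exists i t, [/\ entry_time w i = Some t, (t + m <= n)%N
                & time_lt n (entry_time w i.+1)].

End split_times.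

Section split_chain.
Context d d' (S : measurableType d) (Omega : measurableType d') (R : realType).
Variables (P : R.-pker S ~> S) (C : set S) (m : nat) (lam : R).
Variables (phi : probability S R) (Q : R.-pker S ~> S).
Variable Br : R.-pker (S * S) ~> (m.-1.-tuple S).
Variables (X : nat -> Omega -> S) (B : nat -> Omega -> bool).

Definition trajectory (w : Omega) : nat -> S := X^~ w.
Definition coins (w : Omega) : nat -> bool := B^~ w.

(* Everything generated before time [n]'s draw, for [n] an entry time or a
   running time: X_0, ..., X_n and the coins tossed at entry times before [n]. *)
Definition history (n : nat) : set (set Omega) :=
  <<s [set A | exists k D, [/\ (k <= n)%N, measurable D & A = X k @^-1` D]] `|`
      [set A | exists2 k, (k < n)%N &
         A = [set w | is_entry_time C m (trajectory w) k /\ B k w]] >>.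

Definition endpoint_law (b : bool) (x : S) : {measure set S -> \bar R} :=
  match b with true => phi | false => Q x end.

(* Under the probability [mu], started from [x], the pair (X, B) is generated
   by the splitting construction. The last clause is the chain rule for the
   three successive draws made at an entry time [n]: the coin B_n, independent
   of the history; X_{n+m} given B_n; and (X_{n+1}, ..., X_{n+m-1}) given
   (X_n, X_{n+m}). *)
Record split_law (x : S) (mu : {measure set Omega -> \bar R}) : Prop := {
  split_init : forall D, measurable D -> mu (X 0 @^-1` D) = \d_x D ;
  split_run : forall n A D, history n A -> measurable D ->
    (mu (A `&` [set w | running C m (trajectory w) n] `&` X n.+1 @^-1` D) =
     \int[mu]_(w in A `&` [set w | running C m (trajectory w) n]) P (X n w) D)%E ;
  split_block : forall n A b D E, history n A -> measurable D -> measurable E ->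
    (mu (A `&` [set w | is_entry_time C m (trajectory w) n]
           `&` [set w | B n w = b]
           `&` [set w | D [tuple X (n + i.+1) w | i < m.-1]]
           `&` X (n + m) @^-1` E) =
     \int[mu]_(w in A `&` [set w | is_entry_time C m (trajectory w) n])
       ((if b then lam else 1 - lam)%:E *
        \int[endpoint_law b (X n w)]_(y in E) Br (X n w, y) D))%E
}.

End split_chain.

(* \sum_{j < tau} h(X_j), with the convention 0 where tau is infinite. *)
Definition cycle_sum (S : Type) (R : realType) (h : S -> R) (C : set S)
    (m : nat) (w : nat -> S) (b : nat -> bool) : R :=
  if split_tau C m w b is Some t then \sum_(j < t) h (w j) else 0.

Definition poisson_solution d (S : measurableType d) (R : realType)
    (P : R.-pker S ~> S) (h g : S -> R) : Prop :=
  (forall x, (P x).-integrable setT (EFin \o g)) /\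
  (forall x, \int[P x]_y g y - g x = - h x).

(* Main.v *)
(* For each starting point [x], let [K x] be the occupation measure
   A |-> E_x #{n < tau : X_n in A}. On {n < tau} the next state has conditional
   law P (X_n, .), also inside a block, and X_tau has law [phi] and is
   independent of tau; hence K x + phi = \d_x + (K x) P. Every visit to [C]
   before tau falls in one of the blocks of length [m], and each block succeeds
   with probability [lam], so (K x) C <= m / lam, and the drift conditions bound
   (K x) f and (K x) S.
   Poisson's equation does not follow from conditioning on X_1, since tau is not
   1 + tau o theta when X_0 is in [C] and m > 1. Instead, \d_x + P (x, .) K is a
   second finite measure with the same defect of invariance \d_x - phi, so it
   differs from [K x] by a finite signed invariant measure, that is, by a
   multiple of [pi], and [pi] annihilates f_c. *)
Require Import Defs.
From HB Require Import structures.
From mathcomp Require Import all_boot all_order all_algebra.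
From mathcomp Require Import all_classical all_reals all_analysis.
From mathcomp Require Import measurable_realfun lra.

Set Implicit Arguments.
Unset Strict Implicit.
Unset Printing Implicit Defensive.
Import Order.TTheory GRing.Theory Num.Theory.
Import numFieldNormedType.Exports.

Local Open Scope classical_set_scope.
Local Open Scope ring_scope.

(** The coin tossed at the start of a block can stop the cycle only when that block is over, so
    during the block the event {n < tau} does not depend on it. Averaging over this coin recombines
    phi and Q into P^m, and the bridge law then gives back P at each step of the block. This is why
    {n < tau} is cut according to the age of the current block. The drift estimates allow tau to be
    infinite: partial sums give (K x) S < oo, and only then does conservation of mass force tau < oo
    almost surely. Uniqueness of pi is assumed among probability measures only, whereas the
    difference of the two occupation measures is signed. Its Jordan parts must therefore be shown to
    be invariant separately, and mutual singularity makes this possible. Since f_c has no sign, all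
    integrals are taken for f and for the constant 1, and [gstar x] is (K x) f - (pi f) (K x) S. The
    unknown multiple of pi is the same for both functions, hence cancels; the two bounds use 0 <= pi
    f <= b1. *)

(** * Pathwise combinatorics of entry times, blocks and tau *)

Section split_path.
Context {S : Type}.
Variables (C : set S) (m : nat).
Hypothesis m_gt0 : (0 < m)%N.
Variables (w : nat -> S) (b : nat -> bool).

Local Notation entry := (is_entry_time C m w).

Lemma first_time_some p n :
  first_time p = Some n -> p n /\ forall k, p k -> (n <= k)%N.
Proof.
rewrite /first_time; case: pselect => // h [<-]; case: ex_minnP => k /asboolP pk kmin.
by split=> // l pl; apply: kmin; apply/asboolP.
Qed.

Lemma first_time_none p n : first_time p = None -> ~ p n.
Proof.
by rewrite /first_time; case: pselect => // h _ pn; apply: h; exists n; apply/asboolP.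
Qed.

Lemma first_time_ge p n k : time_lt n (first_time p) -> p k -> (n < k)%N.
Proof.
case E : (first_time p) => [t|] /=; last by move=> _ /(first_time_none E).
by move=> nt /(proj2 (first_time_some E)); exact: leq_trans.
Qed.

Lemma entry_time_mem i t : entry_time C m w i = Some t -> C (w t).
Proof.
case: i => [|i] /=; first by move/first_time_some => [].
by case: entry_time => // s /first_time_some [[]].
Qed.

Lemma entry_timeS i t : entry_time C m w i.+1 = Some t ->
  exists2 s, entry_time C m w i = Some s & (s + m <= t)%N.
Proof.
by rewrite /=; case: entry_time => // s /first_time_some [[st _] _]; exists s.
Qed.

Lemma entry_time_lt i j t s : (i < j)%N ->
  entry_time C m w i = Some t -> entry_time C m w j = Some s -> (t + m <= s)%N.
Proof.
elim: j s => // j IH s; rewrite ltnS leq_eqVlt => /predU1P[-> | ij] Ei.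
  by move=> /entry_timeS[t']; rewrite Ei => -[<-].
move=> /entry_timeS[t' /(IH _ ij Ei) tt' t's].
by apply: leq_trans tt' _; apply: leq_trans t's; exact: leq_addr.
Qed.

(** Successive entry times differ by at least [m >= 1]. This lets an induction on the index overtake
    any given time. *)
Lemma entry_time_geq i t : entry_time C m w i = Some t -> (i <= t)%N.
Proof.
elim: i t => // i IH t /entry_timeS[s /IH is_ st].
by apply: leq_trans st; rewrite -addn1 leq_add.
Qed.

Lemma entry_time_inj i j t s : entry_time C m w i = Some t ->
  entry_time C m w j = Some s -> (t < s)%N -> (i < j)%N.
Proof.
move=> Ei Ej ts; case: (ltngtP i j) => // [ji|ij]; last first.
  by move: ts; rewrite ij in Ei; move: Ei; rewrite Ej => -[->]; rewrite ltnn.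
have := entry_time_lt ji Ej Ei => H.
by have := leq_ltn_trans (leq_addr m s) (leq_ltn_trans H ts); rewrite ltnn.
Qed.

(* [n] lies outside every block [T_i, T_i + m). *)
Definition free (n : nat) : Prop :=
  forall k, entry k -> (k < n)%N -> (k + m <= n)%N.

(** If [n] is not an entry time, every T_i stays strictly below it: [free n] gives T_i + m <= n, so
    [n] is a candidate for the next infimum. At index [n] this contradicts [entry_time_geq]. *)
Lemma entry_of_free n : C (w n) -> free n -> entry n.
Proof.
move=> Cn fn.
suff H i : entry n \/ exists2 t, entry_time C m w i = Some t & (t < n)%N.
  have [//|[t /entry_time_geq nt]] := H n.
  by rewrite ltnNge nt.
elim: i => [|i [|[t Et tn]]]; [|by left|].
- case E : (entry_time C m w 0) => [t|]; last by have := first_time_none E Cn.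
  have [_ /(_ _ Cn)] := first_time_some E.
  rewrite leq_eqVlt => /predU1P[<-|tn]; [by left; exists 0%N|by right; exists t].
- have tmn : (t + m <= n)%N by apply: fn tn; exists i.
  case E : (entry_time C m w i.+1) => [s|]; last first.
    by move: E => /=; rewrite Et => /first_time_none /(_ (conj tmn Cn)).
  have := E; rewrite /= Et => /first_time_some [_ /(_ _ (conj tmn Cn))].
  rewrite leq_eqVlt => /predU1P[<-|sn]; [by left; exists i.+1|by right; exists s].
Qed.

(** The recursion on the index becomes a test on X_n and on entries at the previous [m - 1] times.
    Measurability of the entry events rests on this local form. *)
Lemma entry_timeP n : entry n <-> C (w n) /\ free n.
Proof.
split=> [[i Ei]|[]]; last exact: entry_of_free.
split; first exact: entry_time_mem Ei.
move=> k [j Ej] kn; exact: entry_time_lt (entry_time_inj Ej Ei kn) Ej Ei.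
Qed.

(** The converse climbs along the entry times as in [entry_of_free]; here T_i = n is excluded
    because X_n is outside [C], and the climb can only end with [n] before the next entry. *)
Lemma runningP n : running C m w n <-> ~ C (w n) /\ free n.
Proof.
split=> [[n0|[i [t [Et tn nS]]]]|[nC fn]].
- split; first by move=> /(first_time_ge n0); rewrite ltnn.
  move=> k [j Ej] /ltnW kn; exfalso.
  by have := leq_trans (first_time_ge n0 (entry_time_mem Ej)) kn; rewrite ltnn.
- split.
    by move: nS => /= + Cn; rewrite Et => /first_time_ge/(_ (conj tn Cn)); rewrite ltnn.
  move=> k [j Ej] kn; have [ji|ij] := leqP j i.
    apply: leq_trans tn; rewrite leq_add2r; move: ji; rewrite leq_eqVlt.
    case/predU1P => [ji|ji]; first by move: Et; rewrite -ji Ej => -[->].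
    by apply: leq_trans (entry_time_lt ji Ej Et); exact: leq_addr.
  have := entry_time_lt ij Et Ej => tk; exfalso.
  move: nS; rewrite /= Et => /first_time_ge/(_ (conj tk (entry_time_mem Ej))) nk.
  by have := ltn_trans nk kn; rewrite ltnn.
- suff H i : running C m w n \/ exists2 t, entry_time C m w i = Some t & (t < n)%N.
    have [//|[t /entry_time_geq nt]] := H n.
    by rewrite ltnNge nt.
  elim: i => [|i [|[t Et tn]]]; [|by left|].
  + have [H|] := pselect (time_lt n (entry_time C m w 0)); first by left; left.
    case E : (entry_time C m w 0) => [t|] /=; last by case.
    move=> /negP; rewrite -leqNgt leq_eqVlt.
    case/predU1P=> [tn|tn]; last by right; exists t.
    by case: nC; rewrite -tn; exact: entry_time_mem E.
  + have tmn : (t + m <= n)%N by apply: fn tn; exists i.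
    have [H|] := pselect (time_lt n (entry_time C m w i.+1)).
      by left; right; exists i, t.
    case E : (entry_time C m w i.+1) => [s|] /=; last by case.
    move=> /negP; rewrite -leqNgt leq_eqVlt.
    case/predU1P=> [sn|sn]; last by right; exists s.
    by case: nC; rewrite -sn; exact: entry_time_mem E.
Qed.

Lemma entry_uniq k l n : entry k -> entry l -> (k <= n)%N -> (n < k + m)%N ->
  (l <= n)%N -> (n < l + m)%N -> k = l.
Proof.
move=> ek el kn nk ln nl; case: (ltngtP k l) => // [kl|lk].
- have [_ /(_ _ ek kl) H] := (entry_timeP l).1 el.
  by move: nk; rewrite ltnNge (leq_trans H ln).
- have [_ /(_ _ el lk) H] := (entry_timeP k).1 ek.
  by move: nl; rewrite ltnNge (leq_trans H kn).
Qed.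

(** The strict inequality leaves out a coin tossed at [n], so that the event belongs to the history
    preceding the draws at [n]. *)
Definition no_success (n : nat) : Prop :=
  forall k, (k < n)%N -> ~ (entry k /\ b k).

Lemma split_tau_some s : split_tau C m w b = Some s <->
  exists t, [/\ s = (t + m)%N, entry t, b t & no_success t].
Proof.
rewrite /split_tau /success_index; split.
- case E : first_time => [i|//]; have [[t Et bt] imin] := first_time_some E.
  rewrite Et /= => -[<-]; exists t; split=> //; first by exists i.
  move=> k kt [[j Ej] bk]; have ji := entry_time_inj Ej Et kt.
  by have := imin j (ex_intro2 _ _ k Ej bk); rewrite leqNgt ji.
- move=> [t [-> [i Ei] bt ns]].
  case E : first_time => [j|]; last first.
    by have := first_time_none E (ex_intro2 _ _ t Ei bt).
  have [[u Eu bu] jmin] := first_time_some E.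
  have := jmin i (ex_intro2 _ _ t Ei bt); rewrite leq_eqVlt => /predU1P[->|ji].
    by rewrite Ei.
  exfalso; apply: (ns u); last by split=> //; exists j.
  apply: leq_trans (entry_time_lt ji Eu Ei).
  by rewrite -[ltnLHS]addn0 ltn_add2l.
Qed.

Lemma split_tau_gt j : time_lt j (split_tau C m w b) <->
  forall t, entry t -> b t -> (j < t + m)%N.
Proof.
split.
- move=> H t et bt.
  have ex : exists n, `[< entry n /\ b n >] by exists t; apply/asboolP.
  case: (ex_minnP ex) => s /asboolP[es bs] smin.
  suff E : split_tau C m w b = Some (s + m)%N.
    move: H; rewrite E /= => H; apply: (leq_trans H).
    by rewrite leq_add2r; apply: smin; apply/asboolP.
  apply/split_tau_some; exists s; split=> // k ks Hk.
  by have := smin k (asboolT Hk); rewrite leqNgt ks.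
- case E : split_tau => [s|//] /=; have [t [-> et bt _]] := (split_tau_some s).1 E.
  exact.
Qed.

(** Here [i] is the age of the block containing [j]. Only coins before the start [j - i] matter,
    since a success at [j - i] itself puts tau at [j - i + m > j]. *)
Lemma split_tau_gt_cases j : time_lt j (split_tau C m w b) <->
  (running C m w j /\ no_success j) \/
  (exists2 i, (i < m)%N & (i <= j)%N /\ entry (j - i) /\ no_success (j - i)).
Proof.
rewrite split_tau_gt; split.
- move=> H; have ns n : (n <= j)%N -> free n -> no_success n.
    move=> nj fn k kn [ek bk]; have := H k ek bk.
    by rewrite ltnNge (leq_trans (fn k ek kn) nj).
  have [fj|nfj] := pselect (free j).
    have [Cj|nCj] := pselect (C (w j)); [right|left].
      exists 0%N; rewrite // subn0; split=> //; split; last exact: ns.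
      exact/entry_timeP.
    by split; [apply/runningP|exact: ns].
  right; move/existsNP: nfj => [k /not_implyP[ek /not_implyP[kj /negP]]].
  rewrite -ltnNge => jk; exists (j - k)%N; first by rewrite ltn_subLR // ltnW.
  rewrite leq_subr subKn ?(ltnW kj) //; split=> //; split=> //.
  by apply: ns; [exact: ltnW|have [] := (entry_timeP k).1 ek].
- case=> [[/runningP[nC fj] ns] t et bt|[i im [ij [e ns]]] t et bt].
    have [tj|jt] := ltnP t j; first by case: (ns t tj).
    by apply: (leq_ltn_trans jt); rewrite -[ltnLHS]addn0 ltn_add2l.
  have [tj|jt] := ltnP t (j - i)%N; first by case: (ns t tj).
  by apply: leq_trans (leq_add jt (leqnn m)); rewrite -(ltn_add2r i) addnAC subnK // ltn_add2l.
Qed.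

Lemma running_notin_block j i : (i < m)%N -> (i <= j)%N -> running C m w j ->
  ~ entry (j - i).
Proof.
move=> im ij /runningP[nC fj] e.
have [i0|i0] := posnP i.
  by move: e; rewrite i0 subn0 => /entry_timeP[/nC].
have := fj _ e; rewrite -(ltn_add2r i) subnK // -[ltnLHS]addn0 ltn_add2l i0 => /(_ isT).
by rewrite -(leq_add2r i) addnAC subnK // leq_add2l leqNgt im.
Qed.

End split_path.

(** * Integration against a mixture of measures *)

Section mixture.
Context d d' (T : measurableType d) (S : measurableType d') (R : realType).
Variables (mu : {measure set T -> \bar R}) (D : set T) (mD : measurable D).
Variable K : T -> {measure set S -> \bar R}.
Hypothesis mK : forall A, measurable A -> measurable_fun [set: T] (K ^~ A : T -> \bar R).
Variable nu : {measure set S -> \bar R}.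
Hypothesis nuE : forall A, measurable A -> nu A = (\int[mu]_(t in D) K t A)%E.

Import HBNNSimple.
Local Open Scope ereal_scope.

Let integral_nnsfun_mixture (h : {nnsfun S >-> R}) :
  \int[nu]_y (h y)%:E = \int[mu]_(t in D) \int[K t]_y (h y)%:E.
Proof.
have hE (rho : {measure set S -> \bar R}) :
    \int[rho]_y (h y)%:E = \sum_(r \in range h) (r%:E * rho (h @^-1` [set r])).
  under eq_integral do rewrite fimfunE -fsumEFin//.
  rewrite ge0_integral_fsum//; last 2 first.
    by move=> r; exact/measurable_EFinP/measurableT_comp.
    by move=> r z _; rewrite EFinM nnfun_muleindic_ge0.
  apply: eq_fsbigr => r _.
  rewrite (integralZl_indic _ (fun r => h @^-1` [set r]))//; last first.
    by move=> r0; rewrite preimage_nnfun0.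
  by rewrite integral_indic// setIT.
rewrite hE; under [RHS]eq_integral do rewrite hE.
rewrite ge0_integral_fsum//; last 2 first.
- move=> r; apply: measurable_funeM.
  by apply: measurable_funS (mK _) => //; exact: measurable_sfunP.
- move=> r t _; have := mulemu_ge0 (fun r => h @^-1` [set r]).
  by apply; exact: preimage_nnfun0.
apply: eq_fsbigr => r _; rewrite nuE//.
have [r0|r0] := leP 0%R r.
  by rewrite ge0_integralZl_EFin//; apply: measurable_funS (mK _).
by rewrite preimage_nnfun0// !integral0_eq ?mule0// => t _; rewrite measure0 ?mule0.
Qed.

(** Simple functions, then monotone convergence. [K] is a bare family of measures with measurable
    evaluations, so the same lemma serves kernels, conditional laws and occupation measures. *)
Lemma ge0_integral_mixture (k : S -> \bar R) :
  measurable_fun setT k -> (forall y, 0 <= k y) ->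
  \int[nu]_y k y = \int[mu]_(t in D) \int[K t]_y k y.
Proof.
move=> mk k0; pose k_ := nnsfun_approx measurableT mk.
have limE (rho : {measure set S -> \bar R}) :
    \int[rho]_y k y = limn (fun n => \int[rho]_y (k_ n y)%:E).
  rewrite -monotone_convergence//; last 3 first.
  - by move=> n; exact/measurable_EFinP.
  - by move=> n z _; rewrite lee_fin.
  - by move=> z _ a b ab; rewrite lee_fin; exact/lefP/nd_nnsfun_approx.
  by apply/eq_integral => z _; apply/esym/cvg_lim => //=; exact: cvg_nnsfun_approx.
rewrite limE; under eq_fun do rewrite integral_nnsfun_mixture.
rewrite -monotone_convergence//; last 3 first.
- move=> n; apply: (@measurable_funS _ _ _ _ setT) => //.
  apply: measurable_fun_integral_kernel => //; last exact/measurable_EFinP.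
  by move=> z; rewrite lee_fin.
- by move=> n t _; apply: integral_ge0 => z _; rewrite lee_fin.
- move=> t _ a b ab; apply: ge0_le_integral => //.
  + by move=> z _; rewrite lee_fin.
  + exact/measurable_EFinP.
  + exact/measurable_EFinP.
  + by move=> z _; rewrite lee_fin; exact/lefP/nd_nnsfun_approx.
by apply: eq_integral => t _; rewrite -limE.
Qed.

End mixture.

(** * Finite invariant measures when the stationary law is unique *)

Section invariant_measures.
Context d (S : measurableType d) (R : realType) (P : R.-pker S ~> S).
Local Open Scope ereal_scope.

Lemma integral_kernel_setT (sigma : {measure set S -> \bar R}) :
  \int[sigma]_y P y setT = sigma setT.
Proof. by under eq_integral do rewrite prob_kernel; rewrite integral_cst// mul1e. Qed.

Lemma integral_kernel_le (sigma : {measure set S -> \bar R}) A B :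
  measurable A -> measurable B -> A `<=` B ->
  \int[sigma]_y P y A <= \int[sigma]_y P y B.
Proof.
move=> mA mB AB; apply: ge0_le_integral => //; try exact: measurable_kernel.
by move=> y _; apply: le_measure; rewrite ?inE.
Qed.

Lemma integral_kernel_fin_num (sigma : {measure set S -> \bar R}) A :
  measurable A -> sigma setT < +oo -> \int[sigma]_y P y A \is a fin_num.
Proof.
move=> mA foo; rewrite ge0_fin_numE ?integral_ge0//.
by apply: le_lt_trans foo; rewrite -integral_kernel_setT integral_kernel_le.
Qed.

Lemma measure_fin_num (sigma : {measure set S -> \bar R}) A :
  measurable A -> sigma setT < +oo -> sigma A \is a fin_num.
Proof.
move=> mA foo; rewrite ge0_fin_numE//.
by apply: le_lt_trans foo; apply: le_measure; rewrite ?inE.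
Qed.

(** [P] conserves total mass, so the inequalities for [A] and for its complement add up to an
    equality of finite numbers; neither can be strict. *)
Lemma invariant_of_subinvariant (sigma : {measure set S -> \bar R}) :
  sigma setT < +oo ->
  (forall A, measurable A -> sigma A <= \int[sigma]_y P y A) ->
  forall A, measurable A -> \int[sigma]_y P y A = sigma A.
Proof.
move=> foo sub A mA; have mcA := measurableC mA.
have H1 : sigma A + sigma (~` A) = sigma setT by rewrite -measureU ?setICr ?setUCr//.
have H2 : \int[sigma]_y P y A + \int[sigma]_y P y (~` A) = sigma setT.
  rewrite -ge0_integralD//; try exact: measurable_kernel.
  rewrite -integral_kernel_setT; apply: eq_integral => y _.
  by rewrite -measureU ?setICr ?setUCr//.
have := sub _ mcA; have := sub _ mA.
have := integral_kernel_fin_num mcA foo; have := integral_kernel_fin_num mA foo.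
have := measure_fin_num mcA foo; have := measure_fin_num mA foo; move: H1 H2.
move: (sigma A) (sigma (~` A)) (\int[sigma]_y P y A)
  (\int[sigma]_y P y (~` A)) => a b p q.
move: (sigma setT) => T.
case: a b p q => [a||] [b||] [p||] [q||]//; case: T => [t||]// [H1] [H2] _ _ _ _.
by rewrite !lee_fin => H3 H4; congr EFin; lra.
Qed.

Lemma invariant_multiple (pi : probability S R) (sigma : {measure set S -> \bar R}) :
  (forall mu : probability S R, stationary P mu ->
     forall A, measurable A -> mu A = pi A) ->
  sigma setT < +oo ->
  (forall A, measurable A -> \int[sigma]_y P y A = sigma A) ->
  forall A, measurable A -> sigma A = (fine (sigma setT))%:E * pi A.
Proof.
move=> pi_unique foo inv A mA.
have fT := measure_fin_num measurableT foo.
(* The null measure is set apart because [mnormalize] would return its default [pi] there. *)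
have [s0|s0] := eqVneq (sigma setT) 0.
  rewrite s0 mul0e; apply/eqP; rewrite eq_le measure_ge0 andbT -s0.
  by apply: le_measure; rewrite ?inE.
have c0 : (0 <= (fine (sigma setT))^-1)%R by rewrite invr_ge0 fine_ge0.
have sE B : mnormalize sigma pi B = mscale (NngNum c0) sigma B.
  rewrite /= /mnormalize (negbTE s0) (lt_eqF foo) /= /mscale/= muleC.
  by congr (_ * _); rewrite -[in LHS](fineK fT).
have st : stationary P (mnormalize sigma pi).
  move=> B mB; rewrite (eq_measure_integral (mscale (NngNum c0) sigma)); last first.
    by move=> U _ _; exact: sE.
  rewrite ge0_integral_mscale//; last exact: measurable_kernel.
  by rewrite inv//; exact/esym/sE.
rewrite -(pi_unique _ st)// [X in _ * X]sE /mscale/= muleA -EFinM divff ?mul1e//.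
by rewrite fine_eq0.
Qed.

Lemma difference_charge (alpha beta : {measure set S -> \bar R}) :
  alpha setT < +oo -> beta setT < +oo ->
  exists nu : {charge set S -> \bar R}, forall A, nu A = alpha A - beta A.
Proof.
move=> aoo boo.
exists (cadd (charge_of_finite_measure (mfrestr measurableT aoo))
  (copp (charge_of_finite_measure (mfrestr measurableT boo)))) => A.
have E (x : {measure set S -> \bar R}) (xoo : x setT < +oo) :
  charge_of_finite_measure (mfrestr measurableT xoo) A = x A.
  by rewrite /charge_of_finite_measure /= /mfrestr /= /mrestr setIT.
transitivity (charge_of_finite_measure (mfrestr measurableT aoo) A -
  charge_of_finite_measure (mfrestr measurableT boo) A); first by [].
by rewrite !E.
Qed.

(** Hahn decomposition of [alpha - beta], stated with sums to keep extended-real subtraction out of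
    what follows. [Pos] and [Neg] record the mutual singularity of the two parts. *)
Lemma jordan_decomposition_difference (alpha beta : {measure set S -> \bar R}) :
  alpha setT < +oo -> beta setT < +oo ->
  exists (p n : {measure set S -> \bar R}) (Pos Neg : set S),
  [/\ p setT < +oo, n setT < +oo, measurable Pos & measurable Neg] /\
  forall A, measurable A ->
  [/\ alpha A + n A = beta A + p A, p A = p (A `&` Pos), n (A `&` Pos) = 0,
      n A = n (A `&` Neg) & p (A `&` Neg) = 0].
Proof.
move=> aoo boo.
have [nu nuE] := difference_charge aoo boo.
have [Pos [Neg hahn]] := Hahn_decomposition nu.
have [[mPos _] [mNeg _] PN PN0] := hahn.
pose p := jordan_pos hahn; pose n := jordan_neg hahn.
have pE A : measurable A -> p A = alpha (A `&` Pos) - beta (A `&` Pos).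
  by move=> mA; rewrite -nuE /p jordan_posE cjordan_posE /crestr0 mem_set.
have nE A : measurable A -> n A = beta (A `&` Neg) - alpha (A `&` Neg).
  move=> mA; transitivity (- nu (A `&` Neg)).
    by rewrite /n jordan_negE cjordan_negE /crestr0 mem_set.
    rewrite nuE fin_num_oppeB; last exact: (measure_fin_num (measurableI _ _ mA mNeg) boo).
  by rewrite addeC.
have poo : p setT < +oo.
  by rewrite ltey_eq fin_num_measure.
have noo : n setT < +oo.
  by rewrite ltey_eq fin_num_measure.
have fin (x : {measure set S -> \bar R}) : x setT < +oo ->
    forall A, measurable A -> x A \is a fin_num.
  by move=> xoo A mA; exact: measure_fin_num.
have eq1 A : measurable A -> alpha A + n A = beta A + p A.
  move=> mA; have : alpha A - beta A = p A - n A.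
    by rewrite -nuE (jordan_decomp hahn mA) /cadd /= cscaleN1.
  have := fin _ aoo _ mA; have := fin _ boo _ mA.
  have := fin _ poo _ mA; have := fin _ noo _ mA.
  move: (alpha A) (beta A) (p A) (n A).
  by move=> [x1||] [x2||] [x3||] [x4||]// _ _ _ _ [h]; congr EFin; lra.
have p1 A : measurable A -> p A = p (A `&` Pos).
  by move=> mA; rewrite !pE -?setIA ?setIid//; exact: measurableI.
have n0 A : measurable A -> n (A `&` Pos) = 0.
  by move=> mA; rewrite nE -?setIA ?PN0 ?setI0 ?measure0 ?sube0//; exact: measurableI.
have n1 A : measurable A -> n A = n (A `&` Neg).
  by move=> mA; rewrite !nE -?setIA ?setIid//; exact: measurableI.
have p0 A : measurable A -> p (A `&` Neg) = 0.
  move=> mA; rewrite pE; last exact: measurableI.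
  by rewrite -setIA (setIC Neg) PN0 !setI0 !measure0 sube0.
exists p, n, Pos, Neg; split=> // A mA.
by split; [exact: eq1|exact: p1|exact: n0|exact: n1|exact: p0].
Qed.

(** The Jordan parts satisfy p + nP = n + pP. Inside [Pos], where [n] vanishes, this gives p <= pP,
    so [p] is subinvariant, hence invariant; [n] is treated alike inside [Neg]. The constants are
    the total masses of [n] and [p]. *)
Lemma invariant_difference (pi : probability S R) (alpha beta : {measure set S -> \bar R}) :
  (forall mu : probability S R, stationary P mu ->
     forall A, measurable A -> mu A = pi A) ->
  alpha setT < +oo -> beta setT < +oo ->
  (forall A, measurable A ->
     alpha A + \int[beta]_y P y A = beta A + \int[alpha]_y P y A) ->
  exists c c' : {nonneg R}, forall A, measurable A ->
    alpha A + c%:num%:E * pi A = beta A + c'%:num%:E * pi A.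
Proof.
move=> pi_unique aoo boo H.
have [p [n [Pos [Neg [[poo noo mPos mNeg] pn]]]]] :=
  jordan_decomposition_difference aoo boo.
have eq1 A : measurable A -> alpha A + n A = beta A + p A by move=> /pn[].
have fin (x : {measure set S -> \bar R}) : x setT < +oo ->
    forall A, measurable A -> x A \is a fin_num.
  by move=> xoo A mA; exact: measure_fin_num.
have eq2 A : measurable A -> \int[alpha]_y P y A + \int[n]_y P y A =
    \int[beta]_y P y A + \int[p]_y P y A.
  move=> mA; have mP := measurable_kernel P A mA.
  rewrite -!ge0_integral_measure_add//; apply: eq_measure_integral => B mB _.
  etransitivity; first exact: measure_addE.
  by rewrite eq1//; exact/esym/measure_addE.
have eq3 A : measurable A -> p A + \int[n]_y P y A = n A + \int[p]_y P y A.
  move=> mA; have := H _ mA; have := eq1 _ mA; have := eq2 _ mA.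
  have := fin _ aoo _ mA; have := fin _ boo _ mA.
  have := fin _ poo _ mA; have := fin _ noo _ mA.
  have := integral_kernel_fin_num mA aoo; have := integral_kernel_fin_num mA boo.
  have := integral_kernel_fin_num mA poo; have := integral_kernel_fin_num mA noo.
  move: (alpha A) (beta A) (p A) (n A) (\int[alpha]_y P y A)
    (\int[beta]_y P y A) (\int[p]_y P y A) (\int[n]_y P y A).
  move=> [x1||]// [x2||]// [x3||]// [x4||]// [x5||]// [x6||]// [x7||]// [x8||]// _ _ _ _ _ _ _ _.
  by move=> [h1] [h2] [h3]; congr EFin; lra.
have pI A : measurable A -> \int[p]_y P y A = p A.
  apply: invariant_of_subinvariant => // {}A mA.
  have mAP := measurableI _ _ mA mPos.
  have [_ -> n0 _ _] := pn _ mA.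
  apply: (@le_trans _ _ (\int[p]_y P y (A `&` Pos))); last exact: integral_kernel_le.
  by rewrite -[leRHS]add0e -n0 -eq3// leeDl// integral_ge0.
have nI A : measurable A -> \int[n]_y P y A = n A.
  apply: invariant_of_subinvariant => // {}A mA.
  have mAN := measurableI _ _ mA mNeg.
  have [_ _ _ -> p0] := pn _ mA.
  apply: (@le_trans _ _ (\int[n]_y P y (A `&` Neg))); last exact: integral_kernel_le.
  by rewrite -[leRHS]add0e -p0 eq3// leeDl// integral_ge0.
exists (NngNum (fine_ge0 (measure_ge0 n setT))), (NngNum (fine_ge0 (measure_ge0 p setT))).
move=> A mA /=.
rewrite -(invariant_multiple pi_unique noo nI mA).
by rewrite -(invariant_multiple pi_unique poo pI mA) eq1.
Qed.

End invariant_measures.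

(** * Bound on pi f from the drift condition *)

Section drift.
Context d (S : measurableType d) (R : realType) (P : R.-pker S ~> S).
Local Open Scope ereal_scope.

(* [v] need not be [pi]-integrable, so the drift inequality is integrated for
   the truncations [minr v N]. *)
Lemma stationary_drift_bound (pi : probability S R) (f v : S -> R) (b : R) :
  stationary P pi ->
  measurable_fun setT f -> (forall x, 0 <= f x)%R ->
  measurable_fun setT v -> (forall x, 0 <= v x)%R -> (0 <= b)%R ->
  (forall x, \int[P x]_y (v y)%:E <= (v x - f x + b)%:E) ->
  \int[pi]_x (f x)%:E <= b%:E.
Proof.
move=> st mf f0 mv v0 b0 dr.
pose vN (N : nat) x := Num.min (v x) N%:R.
(* Where [v > N], truncation leaves only P (min v N) <= N, with no room for [f], so [f] is cut off
   there. Where [v <= N] the original drift inequality applies. *)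
pose fN (N : nat) x := (f x * \1_[set y | (v y <= N%:R)%R] x)%R.
have mvN N : measurable_fun setT (vN N) by apply: measurable_minr.
have vN0 N x : (0 <= vN N x)%R by rewrite le_min v0 ler0n.
have mset N : measurable [set y | (v y <= N%:R)%R].
  rewrite (_ : [set _ | _] = v @^-1` `]-oo, N%:R]%classic).
    by rewrite -[X in measurable X]setTI; exact: mv.
  by apply/seteqP; split=> y /=; rewrite in_itv.
have mfN N : measurable_fun setT (fN N).
  by apply: measurable_funM => //; exact: measurable_indic.
have fN0 N x : (0 <= fN N x)%R by rewrite mulr_ge0// indicE.
have fNb N : \int[pi]_x (fN N x)%:E <= b%:E.
  have mPv : measurable_fun setT (fun x => \int[P x]_y (vN N y)%:E).
    apply: measurable_fun_integral_kernel; first exact: measurable_kernel.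
      by move=> z; rewrite lee_fin.
    exact/measurable_EFinP.
  have stv : \int[pi]_x (vN N x)%:E = \int[pi]_x \int[P x]_y (vN N y)%:E.
    apply: ge0_integral_mixture => //.
    - by move=> A mA; exact: measurable_kernel.
    - by move=> A mA; rewrite st.
    - exact/measurable_EFinP.
    - by move=> y; rewrite lee_fin.
  have vNfin : \int[pi]_x (vN N x)%:E \is a fin_num.
    rewrite ge0_fin_numE; last by apply: integral_ge0 => x _; rewrite lee_fin.
    apply: (@le_lt_trans _ _ (\int[pi]_x (N%:R)%:E)); last first.
      by rewrite integral_cst//= probability_setT mule1 ltry.
    apply: ge0_le_integral => //.
    - by move=> x _; rewrite lee_fin.
    - exact/measurable_EFinP.
    - by move=> x _; rewrite lee_fin ge_min lexx orbT.
  have : \int[pi]_x (fN N x)%:E + \int[pi]_x (vN N x)%:E <=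
         \int[pi]_x (vN N x)%:E + b%:E.
    rewrite [X in _ + X]stv -ge0_integralD//; last 3 first.
    - by move=> x _; rewrite lee_fin.
    - exact/measurable_EFinP.
    - by move=> x _; apply: integral_ge0 => y _; rewrite lee_fin.
    rewrite -[X in _ <= _ + X](_ : \int[pi]_x b%:E = _); last first.
      by rewrite integral_cst//= probability_setT mule1.
    rewrite -ge0_integralD//; last 2 first.
    - by move=> x _; rewrite lee_fin.
    - exact/measurable_EFinP.
    apply: ge0_le_integral => //.
    - by move=> x _; rewrite adde_ge0 ?lee_fin// integral_ge0// => y _; rewrite lee_fin.
    - by apply: emeasurable_funD => //; exact/measurable_EFinP.
    - by apply: emeasurable_funD => //; exact/measurable_EFinP.
    move=> x _.
    have Pv : \int[P x]_y (vN N y)%:E <= (v x - f x + b)%:E.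
      apply: le_trans (dr x); apply: ge0_le_integral => //.
      - by move=> y _; rewrite lee_fin.
      - exact/measurable_EFinP.
      - exact/measurable_EFinP.
      - by move=> y _; rewrite lee_fin ge_min lexx.
    have PN : \int[P x]_y (vN N y)%:E <= N%:R%:E.
      apply: (@le_trans _ _ (\int[P x]_y (N%:R)%:E)); last first.
        by rewrite integral_cst// prob_kernel mule1.
      apply: ge0_le_integral => //.
      - by move=> y _; rewrite lee_fin.
      - exact/measurable_EFinP.
      - by move=> y _; rewrite lee_fin ge_min lexx orbT.
    rewrite /fN /vN indicE; have [vx|vx] := leP (v x) N%:R.
      rewrite mem_set//= mulr1; apply: (le_trans (leeD2l _ Pv)).
      by rewrite -!EFinD lee_fin; lra.
    rewrite memNset/= ?mulr0 ?add0e; last by apply/negP; rewrite -ltNge.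
    by apply: (le_trans PN); rewrite -EFinD lee_fin lerDl.
  by rewrite addeC leeD2lE.
have fE x : (f x)%:E = limn (fun N => (fN N x)%:E).
  apply/esym/cvg_lim => //; apply: cvg_near_cst.
  exists (Num.truncn (v x)).+1 => // N /= vN_.
  rewrite /fN indicE mem_set ?mulr1//=.
  apply: ltW; apply: (lt_le_trans (truncnS_gt _)).
  by rewrite ler_nat.
under eq_integral do rewrite fE.
rewrite monotone_convergence//; last 3 first.
- by move=> N; exact/measurable_EFinP.
- by move=> N x _; rewrite lee_fin.
- move=> x _ n k nk; rewrite lee_fin ler_wpM2l// !indicE ler_nat.
  case: (boolP (x \in _)) => //; rewrite inE /= => vn.
  by rewrite mem_set//=; apply: (le_trans vn); rewrite ler_nat.
apply: lime_le; last by apply: nearW.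
apply: ereal_nondecreasing_is_cvgn => n k nk; apply: ge0_le_integral => //.
- by move=> x _; rewrite lee_fin.
- exact/measurable_EFinP.
- exact/measurable_EFinP.
move=> x _; rewrite lee_fin ler_wpM2l// !indicE ler_nat.
case: (boolP (x \in _)) => //; rewrite inE /= => vn.
by rewrite mem_set//=; apply: (le_trans vn); rewrite ler_nat.
Qed.

End drift.

(** * Powers of P and marginals of the path laws *)

Section kernel_powers.
Context d (S : measurableType d) (R : realType) (P : R.-pker S ~> S).
Local Open Scope ereal_scope.

Lemma kernel_iter0 x A : kernel_iter P 0 x A = \d_x A.
Proof. by []. Qed.

Lemma kernel_iterS n x A :
  kernel_iter P n.+1 x A = \int[P x]_y kernel_iter P n y A.
Proof. by []. Qed.

Lemma kernel_iter_setT n x : kernel_iter P n x setT = 1.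
Proof.
elim: n x => [|n IH] x; first by rewrite kernel_iter0 diracT.
rewrite kernel_iterS; under eq_integral do rewrite IH.
by rewrite integral_cst// mul1e prob_kernel.
Qed.

Lemma kernel_iter1 x A : measurable A -> kernel_iter P 1 x A = P x A.
Proof.
move=> mA; rewrite kernel_iterS.
by under eq_integral do rewrite kernel_iter0; rewrite integral_indic// setIT.
Qed.

Lemma kernel_iterSr n x A : measurable A ->
  kernel_iter P n.+1 x A = \int[kernel_iter P n x]_y P y A.
Proof.
move=> mA; have mPA := measurable_kernel P A mA.
elim: n x => [|n IH] x.
  by rewrite kernel_iter1// [RHS]integral_dirac// diracT mul1e.
rewrite kernel_iterS; under eq_integral do rewrite IH.
apply/esym/ge0_integral_mixture => // U mU; exact: measurable_kernel.
Qed.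

(** For the first coordinate in [path_prob_coord]: once that state is drawn, the event no longer
    depends on the rest of the path. *)
Lemma path_prob_cst n x (p : Prop) :
  path_prob P x [set t : n.-tuple S | p] setT = (`[< p >]%:R)%:E.
Proof.
elim: n x => [|n IH] x /=.
  by rewrite prob_kernel mule1 indicE; congr ((_ : bool)%:R%:E); apply/idP/asboolP; rewrite inE.
under eq_integral do rewrite IH.
by rewrite integral_cst// prob_kernel mule1.
Qed.

Lemma path_prob_coord n (i : 'I_n) x A : measurable A ->
  path_prob P x [set t : n.-tuple S | A (tnth t i)] setT = kernel_iter P i.+1 x A.
Proof.
move=> mA; elim: n i x => [[]//|n IH] i x /=.
rewrite kernel_iterS; apply: eq_integral => y _.
case: (unliftP ord0 i) => [j ->|->].
  by rewrite -IH; congr path_prob; apply/seteqP; split=> t /=; rewrite tnthS.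
rewrite kernel_iter0 diracE.
rewrite (_ : [set _ | _] = [set t : n.-tuple S | A y]).
  by rewrite path_prob_cst; congr ((_ : bool)%:R%:E); apply/asboolP/idP; rewrite inE.
by apply/seteqP; split=> t /=; rewrite tnth0.
Qed.

End kernel_powers.

(** * Law of a random state restricted to an event *)

Section law_on.
Context d d' (T : measurableType d) (S : measurableType d') (R : realType).
Variables (mu : {measure set T -> \bar R}) (W : set T) (Y : T -> S).
Local Open Scope ereal_scope.

Definition law_on of measurable W & measurable_fun setT Y :=
  fun A : set S => mu (W `&` Y @^-1` A).

Hypotheses (mW : measurable W) (mY : measurable_fun setT Y).

Let mpre A : measurable A -> measurable (Y @^-1` A).
Proof. by move=> mA; rewrite -[X in measurable X]setTI; exact: mY. Qed.

Let law_on0 : law_on mW mY set0 = 0.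
Proof. by rewrite /law_on preimage_set0 setI0 measure0. Qed.

Let law_on_ge0 A : 0 <= law_on mW mY A.
Proof. exact: measure_ge0. Qed.

Let law_on_sigma_additive : semi_sigma_additive (law_on mW mY).
Proof.
move=> F mF tF mUF; rewrite /law_on preimage_bigcup setI_bigcupr.
apply: measure_semi_sigma_additive.
- by move=> n; apply: measurableI => //; exact: mpre.
- apply/trivIsetP => /= i j _ _ ij; rewrite setIACA -preimage_setI.
  by move/trivIsetP : tF => /(_ _ _ _ _ ij) ->//; rewrite preimage_set0 setI0.
- rewrite -setI_bigcupr -preimage_bigcup; apply: measurableI => //; exact: mpre.
Qed.

HB.instance Definition _ := isMeasure.Build _ _ _
  (law_on mW mY) law_on0 law_on_ge0 law_on_sigma_additive.

Lemma law_onE A : law_on mW mY A = mu (W `&` Y @^-1` A).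
Proof. by []. Qed.

Lemma integral_law_on (k : S -> \bar R) :
  measurable_fun setT k -> (forall y, 0 <= k y) ->
  \int[law_on mW mY]_y k y = \int[mu]_(w in W) k (Y w).
Proof.
move=> mk k0.
rewrite (@ge0_integral_mixture _ _ _ _ _ mu W mW (fun w => \d_(Y w)))//.
- by apply: eq_integral => w _; rewrite integral_dirac// diracT mul1e.
- move=> A mA; rewrite (_ : (fun w => _) = EFin \o (\1_(Y @^-1` A))).
    by apply/measurable_EFinP/measurable_indic/mpre.
  by apply/funext => w; rewrite /= diracE indicE.
- by move=> A mA; rewrite [LHS]law_onE setIC -integral_indic//; exact: mpre.
Qed.

(** [K] plays the role of a conditional law of [Y], but is tested only by integration over the
    single event [W]; this is the form in which [attempt_block] and [alive_step] provide it. *)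
Lemma integral_conditional_law (K : T -> {measure set S -> \bar R}) (k : S -> \bar R) :
  (forall A, measurable A -> measurable_fun [set: T] (fun t => K t A : \bar R)) ->
  (forall A, measurable A -> mu (W `&` Y @^-1` A) = \int[mu]_(w in W) K w A) ->
  measurable_fun setT k -> (forall y, 0 <= k y) ->
  \int[mu]_(w in W) k (Y w) = \int[mu]_(w in W) \int[K w]_y k y.
Proof.
move=> mK H mk k0; rewrite -integral_law_on//.
by apply: ge0_integral_mixture => // A mA; rewrite [LHS]law_onE; exact: H.
Qed.

End law_on.

(** * Events of the split chain and their measurability *)

Section split_events.
Context d d' (S : measurableType d) (Omega : measurableType d').
Variables (C : set S) (m : nat) (X : nat -> Omega -> S) (B : nat -> Omega -> bool).
Hypotheses (m_gt0 : (0 < m)%N) (mC : measurable C).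
Hypotheses (mX : forall n, measurable_fun setT (X n)).
Hypotheses (mB : forall n, measurable_fun setT (B n)).

Definition entry_at n := [set w | is_entry_time C m (trajectory X w) n].
Definition running_at n := [set w | running C m (trajectory X w) n].
Definition no_success_before n :=
  [set w | no_success C m (trajectory X w) (coins B w) n].
(** The coin at [n] is left open: this is the event on which the draws of [split_block] are made. *)
Definition attempt n := no_success_before n `&` entry_at n.
Definition alive n := [set w | time_lt n (split_tau C m (trajectory X w) (coins B w))].
Definition stopped_at n := [set w | split_tau C m (trajectory X w) (coins B w) = Some n].

Lemma measurable_state n A : measurable A -> measurable (X n @^-1` A).
Proof. by move=> mA; rewrite -[X in measurable X]setTI; exact: mX. Qed.

Lemma measurable_coin n b : measurable [set w | B n w = b].
Proof.
rewrite (_ : [set _ | _] = B n @^-1` [set b])//.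
by rewrite -[X in measurable X]setTI; exact: mB.
Qed.

Let free_at n := \bigcap_(k in [set k | (k < n)%N /\ (n < k + m)%N]) ~` entry_at k.

Let free_atE n : free_at n = [set w | free C m (trajectory X w) n].
Proof.
apply/seteqP; split=> [w H k ek kn|w H k [kn nk] ek].
  by rewrite leqNgt; apply/negP => nk; apply: (H k).
by have := H k ek kn; rewrite leqNgt nk.
Qed.

Let entry_atE n : entry_at n = X n @^-1` C `&` free_at n.
Proof.
rewrite free_atE; apply/seteqP.
by split=> w; case: (entry_timeP C m_gt0 (trajectory X w) n).
Qed.

Lemma measurable_entry_at n : measurable (entry_at n).
Proof.
elim/ltn_ind: n => n IH; rewrite entry_atE; apply: measurableI; first exact: measurable_state.
by apply: bigcap_measurableType => k [kn _]; apply: measurableC; exact: IH.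
Qed.

Lemma measurable_running_at n : measurable (running_at n).
Proof.
rewrite (_ : running_at n = ~` (X n @^-1` C) `&` free_at n); last first.
  rewrite free_atE; apply/seteqP.
  by split=> w; case: (runningP C m_gt0 (trajectory X w) n).
apply: measurableI; first by apply: measurableC; exact: measurable_state.
by apply: bigcap_measurableType => k _; apply: measurableC; exact: measurable_entry_at.
Qed.

Let no_success_beforeE n : no_success_before n =
  ~` \bigcup_k (if (k < n)%N then entry_at k `&` [set w | B k w] else set0).
Proof.
apply/seteqP; split=> [w H [k _]|w H k kn ek].
  by case: ifPn => // kn ek; exact: (H k).
by apply: H; exists k => //; rewrite kn.
Qed.

Lemma measurable_no_success_before n : measurable (no_success_before n).
Proof.
rewrite no_success_beforeE; apply: measurableC; apply: bigcupT_measurable => k.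
case: ifPn => // _; apply: measurableI; first exact: measurable_entry_at.
exact: (measurable_coin k true).
Qed.

(** Membership in the history is needed for this event alone, because [split_run] and [split_block]
    themselves intersect with the running or entry event. *)
Lemma history_no_success_before n : history C m X B n (no_success_before n).
Proof.
rewrite no_success_beforeE; apply: sigma_algebraC; apply: sigma_algebra_bigcup => k.
case: ifPn => kn; last exact: sigma_algebra0.
by apply: sub_sigma_algebra; right; exists k.
Qed.

Lemma measurable_attempt n : measurable (attempt n).
Proof.
by apply: measurableI; [exact: measurable_no_success_before|exact: measurable_entry_at].
Qed.

Lemma measurable_alive n : measurable (alive n).
Proof.
rewrite (_ : alive n =
  ~` \bigcup_k (if (k + m <= n)%N then entry_at k `&` [set w | B k w] else set0)).
  apply: measurableC; apply: bigcupT_measurable => k; case: ifPn => // _.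
  apply: measurableI; first exact: measurable_entry_at.
  exact: (measurable_coin k true).
apply/seteqP; split=> [w /(split_tau_gt _ m_gt0) H [k _]|w H].
  by case: ifPn => // kn [ek bk]; have := H k ek bk; rewrite ltnNge kn.
apply/(split_tau_gt _ m_gt0) => t et bt; rewrite ltnNge; apply/negP => tn.
by apply: H; exists t => //; rewrite tn.
Qed.

Lemma aliveS_stopped n : alive n = alive n.+1 `|` stopped_at n.+1.
Proof.
apply/seteqP; rewrite /alive /stopped_at; split=> w /=.
- case: split_tau => [t|] /=; last by left.
  by rewrite leq_eqVlt => /orP[/eqP <-|nt]; [right|left].
- by case: split_tau => [t|] //= [/ltnW //|[->]].
Qed.

Lemma alive_stopped_disj n : alive n `&` stopped_at n = set0.
Proof.
apply/seteqP; rewrite /alive /stopped_at; split=> w //= [+ E].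
by rewrite E /= ltnn.
Qed.

Lemma alive0 : alive 0 = setT.
Proof.
apply/seteqP; split=> // w _; apply/(split_tau_gt _ m_gt0) => t _ _.
by rewrite addn_gt0 m_gt0 orbT.
Qed.

Lemma stopped_at_attempt n : stopped_at (n + m) = attempt n `&` [set w | B n w = true].
Proof.
apply/seteqP; split=> [w /(split_tau_some _ m_gt0)[t [/addIn<- et bt ns]]|w [[ns en] bn]] //.
by apply/(split_tau_some _ m_gt0); exists n.
Qed.

Lemma stopped_at_lt n : (n < m)%N -> stopped_at n = set0.
Proof.
move=> nm; apply/seteqP; split=> // w /(split_tau_some _ m_gt0)[t [nE _ _ _]].
by move: nm; rewrite nE ltnNge leq_addl.
Qed.

Lemma measurable_stopped_at n : measurable (stopped_at n).
Proof.
have [nm|mn] := ltnP n m; first by rewrite stopped_at_lt.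
rewrite -(subnK mn) stopped_at_attempt; apply: measurableI.
  exact: measurable_attempt.
exact: measurable_coin.
Qed.

Lemma trivIset_stopped_at : trivIset setT stopped_at.
Proof.
apply/trivIsetP => i j _ _ /eqP ij; apply/seteqP; split=> // w [].
by rewrite /stopped_at /= => -> [].
Qed.

Lemma alive_attempt n : alive n = (no_success_before n `&` running_at n) `|`
  [set w | exists2 i, (i < m)%N & (i <= n)%N /\ attempt (n - i) w].
Proof.
apply/seteqP; split=> [w /(split_tau_gt_cases _ m_gt0)[[]|[i im [i_n [e s]]]]|w].
- by left.
- by right; exists i.
- case=> [[s r]|[i im [i_n [s e]]]]; apply/(split_tau_gt_cases _ m_gt0); first by left.
  by right; exists i.
Qed.

End split_events.

(** * Laws of the states inside a block *)

Section split_law_consequences.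
Context d d' (S : measurableType d) (Omega : measurableType d') (R : realType).
Variables (P : R.-pker S ~> S) (C : set S) (m : nat) (lam : R).
Variables (phi : probability S R) (Q : R.-pker S ~> S).
Variable Br : R.-pker (S * S) ~> (m.-1.-tuple S).
Variables (X : nat -> Omega -> S) (B : nat -> Omega -> bool).
Hypotheses (m_gt0 : (0 < m)%N) (mC : measurable C).
Hypotheses (mX : forall n, measurable_fun setT (X n)).
Hypotheses (mB : forall n, measurable_fun setT (B n)).
Hypotheses (lam_gt0 : 0 < lam) (lam_le1 : lam <= 1).
Hypothesis Q_residual : residual_kernel P C m lam phi Q.
Hypothesis Br_bridge : bridge_kernel P C Br.
Variables (x : S) (mu : {measure set Omega -> \bar R}).
Hypothesis mu1 : mu setT = 1%E.
Hypothesis law : split_law P C lam phi Q Br X B x mu.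
Local Open Scope ereal_scope.

Local Notation no_success_before := (no_success_before C m X B).
Local Notation attempt := (attempt C m X B).
Local Notation alive := (alive C m X B).
Local Notation stopped_at := (stopped_at C m X B).
Local Notation running_at := (running_at C m X).

Let m_attempt n : measurable (attempt n) := measurable_attempt m_gt0 mC mX mB n.
Let m_alive n : measurable (alive n) := measurable_alive m_gt0 mC mX mB n.
Let m_stopped n : measurable (stopped_at n) := measurable_stopped_at m_gt0 mC mX mB n.
Let m_state n A : measurable A -> measurable (X n @^-1` A) := @measurable_state _ _ _ _ _ mX n A.
Let m_coin n b : measurable [set w | B n w = b] := measurable_coin mB n b.

Let attempt_in_C n w : attempt n w -> C (X n w).
Proof. by move=> [_ /(entry_timeP _ m_gt0)[]]. Qed.

Let intermediate n (D : set (m.-1.-tuple S)) :=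
  [set w | D [tuple X (n + i.+1) w | i < m.-1]].

Let m_intermediate n D : measurable D -> measurable (intermediate n D).
Proof.
move=> mD.
have mf : measurable_fun [set: Omega] (fun w => [tuple X (n + i.+1) w | i < m.-1]).
  apply/measurable_fun_tnthP => i.
  rewrite (_ : _ \o _ = X (n + i.+1)) //.
  by apply/funext => w /=; rewrite tnth_mktuple.
by rewrite -[X in measurable X]setTI; exact: mf.
Qed.

(** Averaging over the coin turns phi and Q back into P^m. The residual identity holds only from
    states of [C], which [attempt n w] guarantees. *)
Let residual_integral n w (D : set (m.-1.-tuple S)) (E : set S) :
  measurable D -> measurable E -> attempt n w ->
  lam%:E * \int[phi]_(y in E) Br (X n w, y) D +
    (1 - lam)%:E * \int[Q (X n w)]_(y in E) Br (X n w, y) D =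
  \int[kernel_iter P m (X n w)]_(y in E) Br (X n w, y) D.
Proof.
move=> mD mE /attempt_in_C Cx.
have l1 : (0 <= 1 - lam)%R by rewrite subr_ge0.
have mBr : measurable_fun E (fun y => Br (X n w, y) D : \bar R).
  apply: measurable_funS (measurable_fun_pair2 _ (measurable_kernel Br D mD)) => //.
pose m1 := mscale (NngNum (ltW lam_gt0)) phi.
pose m2 := mscale (NngNum l1) (Q (X n w)).
rewrite [RHS](@eq_measure_integral _ _ _ _ (measure_add m1 m2)); last first.
  move=> A mA _; transitivity (m1 A + m2 A); first exact: Q_residual.
  exact/esym/measure_addE.
rewrite ge0_integral_measure_add//.
by rewrite !ge0_integral_mscale.
Qed.

(** Sum of the [split_block] clauses for the two values of the coin: once the coin is forgotten, a
    block is distributed as a stretch of the original chain. *)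
Let attempt_law n D E : measurable D -> measurable E ->
  mu (attempt n `&` intermediate n D `&` X (n + m) @^-1` E) =
  \int[mu]_(w in attempt n) \int[kernel_iter P m (X n w)]_(y in E) Br (X n w, y) D.
Proof.
move=> mD mE.
have mI := m_intermediate n mD.
pose Z b := attempt n `&` [set w | B n w = b] `&` intermediate n D `&` X (n + m) @^-1` E.
have mZ b : measurable (Z b).
  apply: measurableI; last exact: m_state.
  by apply: measurableI => //; exact: measurableI (m_attempt n) (m_coin n b).
rewrite (_ : _ `&` _ = Z true `|` Z false); last first.
  apply/seteqP; split=> w.
    by move=> [[a i] e]; case Bn : (B n w); [left|right].
  by move=> [[[[a ?] i] e]|[[[a ?] i] e]].
transitivity (mu (Z true) + mu (Z false)).
  apply: measureU => //.
  by apply/seteqP; split=> // w [[[[_ /= Bt] _] _] [[[_ /= Bf] _] _]]; move: Bf; rewrite Bt.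
have [l0 l1] : (0 <= lam)%R /\ (0 <= 1 - lam)%R by rewrite subr_ge0 ltW.
have hist := @history_no_success_before _ _ _ _ C m X B n.
have ZE b : mu (Z b) = \int[mu]_(w in attempt n) ((if b then lam else 1 - lam)%:E *
    \int[endpoint_law phi Q b (X n w)]_(y in E) Br (X n w, y) D).
  exact: (split_block law b hist mD mE).
rewrite !ZE /=.
(* With the indicator of [E] in the integrand, the function is jointly measurable, so the inner
   integrals are measurable in the starting state. *)
have mBE : measurable_fun setT (fun z : S * S => (Br z D * (\1_E z.2)%:E)).
  apply: emeasurable_funM; first exact: measurable_kernel.
  apply/measurable_EFinP; apply: measurableT_comp => //; exact: measurable_indic.
have BE0 z : 0 <= Br z D * (\1_E z.2)%:E by rewrite mule_ge0// lee_fin.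
have resE y (rho : {measure set S -> \bar R}) :
    \int[rho]_(z in E) Br (y, z) D = \int[rho]_z (Br (y, z) D * (\1_E z)%:E).
  by rewrite integral_mkcond; apply: eq_integral => z _; rewrite epatch_indic.
rewrite -ge0_integralD//; last 4 first.
- by move=> w _; rewrite mule_ge0// integral_ge0.
- apply: measurable_funeM; apply: measurable_funTS.
  apply: (measurableT_comp (f := fun y => \int[phi]_(z in E) Br (y, z) D)) => //.
  under eq_fun do rewrite resE.
  exact: (@measurable_fun_fubini_tonelli_F _ _ _ _ _ phi (fun z => Br z D * (\1_E z.2)%:E)).
- by move=> w _; rewrite mule_ge0// integral_ge0.
- apply: measurable_funeM; apply: measurable_funTS.
  apply: (measurableT_comp (f := fun y => \int[Q y]_(z in E) Br (y, z) D)) => //.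
  under eq_fun do rewrite resE.
  exact: (@measurable_fun_integral_sfinite_kernel _ _ _ _ _ (fun z => Br z D * (\1_E z.2)%:E)).
by apply: eq_integral => w; rewrite inE => aw; rewrite -residual_integral.
Qed.

(** After a success the endpoint law phi does not depend on X_n, so the integrand is constant and
    the integral factorizes. *)
Lemma attempt_success n A : measurable A ->
  mu (attempt n `&` [set w | B n w = true] `&` X (n + m) @^-1` A) =
  lam%:E * phi A * mu (attempt n).
Proof.
move=> mA; have hist := @history_no_success_before _ _ _ _ C m X B n.
transitivity (\int[mu]_(w in attempt n) (lam%:E *
    \int[phi]_(y in A) Br (X n w, y) setT)).
  rewrite -[RHS](split_block law true hist measurableT mA).
  by congr (mu (_ `&` _)); rewrite -[LHS]setIT.
rewrite (eq_integral (cst (lam%:E * phi A))) ?integral_cst//.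
by move=> w _ /=; under eq_integral do rewrite prob_kernel; rewrite integral_cst// mul1e.
Qed.

Lemma attempt_block n i A : (i <= m)%N -> measurable A ->
  mu (attempt n `&` X (n + i) @^-1` A) =
  \int[mu]_(w in attempt n) kernel_iter P i (X n w) A.
Proof.
move=> im mA; have [i0|i_gt0] := posnP i.
  rewrite i0 addn0; under eq_integral do rewrite kernel_iter0 diracE.
  by rewrite setIC -integral_indic//; exact: m_state.
move: im; rewrite leq_eqVlt => /predU1P[->|im].
  have := attempt_law n measurableT mA.
  rewrite (_ : intermediate n setT = setT) ?setIT// => ->.
  apply: eq_integral => w _; under eq_integral do rewrite prob_kernel.
  by rewrite integral_cst// mul1e.
(* The tuple starts at X_{n+1}, so X_{n+i} is its coordinate [i.-1]. *)
have im1 : (i.-1 < m.-1)%N by rewrite -ltnS !prednK.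
pose D := [set t : m.-1.-tuple S | A (tnth t (Ordinal im1))].
have mD : measurable D.
  rewrite (_ : D = (@tnth _ S)^~ (Ordinal im1) @^-1` A)//.
  by rewrite -[X in measurable X]setTI; exact: measurable_tnth.
have := attempt_law n mD measurableT.
rewrite preimage_setT setIT (_ : intermediate n D = X (n + i) @^-1` A); last first.
  by apply/seteqP; split=> w; rewrite /intermediate /D /= tnth_mktuple /= prednK.
move=> ->; apply: eq_integral => w; rewrite inE => /attempt_in_C Cx.
rewrite -Br_bridge// path_prob_coord//.
by have -> : (Ordinal im1).+1 = i by rewrite /= prednK.
Qed.

Let mPX n A : measurable A -> measurable_fun [set: Omega] (fun w => P (X n w) A : \bar R).
Proof. by move=> mA; exact: measurableT_comp (measurable_kernel P A mA) (mX n). Qed.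

(** P^{i+1} = P^i P, and on the attempt X_{n+i} has law P^i(X_n, .), so the last step can be
    expressed through X_{n+i}. *)
Lemma attempt_step n i A : (i < m)%N -> measurable A ->
  mu (attempt n `&` X (n + i).+1 @^-1` A) =
  \int[mu]_(w in attempt n) P (X (n + i) w) A.
Proof.
move=> im mA; rewrite -addnS attempt_block//.
under eq_integral do rewrite kernel_iterSr//.
rewrite -(@integral_conditional_law _ _ _ _ _ mu _ _ (m_attempt n) (mX (n + i)%N)
  (fun w => kernel_iter P i (X n w)) (fun y => P y A))//.
- move=> U mU; exact: measurableT_comp (measurable_kernel (kernel_iter P i) U mU) (mX n).
- by move=> U mU; apply: attempt_block => //; exact: ltnW.
- exact: measurable_kernel.
Qed.

(** * One-step balance and drift estimates before tau *)

Lemma alive_step n A : measurable A ->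
  mu (alive n `&` X n.+1 @^-1` A) = \int[mu]_(w in alive n) P (X n w) A.
Proof.
move=> mA.
(* The induction adds the blocks of age [k] one age at a time; [V m] is the whole event
   [alive n]. *)
pose V k := (no_success_before n `&` running_at n) `|`
  [set w | exists2 i, (i < k)%N & (i <= n)%N /\ attempt (n - i) w].
have mrun : measurable (no_success_before n `&` running_at n).
  apply: measurableI; first exact: measurable_no_success_before.
  exact: measurable_running_at.
suff H k : (k <= m)%N -> measurable (V k) /\
    mu (V k `&` X n.+1 @^-1` A) = \int[mu]_(w in V k) P (X n w) A.
  by have [_] := H _ (leqnn m); rewrite /V -alive_attempt.
elim: k => [_|k IH km].
  rewrite (_ : V 0%N = no_success_before n `&` running_at n); last first.
    by apply/seteqP; split=> w; [case=> // -[]|left].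
  split=> //; apply: (split_run law) => //; exact: history_no_success_before.
have [mV VE] := IH (ltnW km).
(* A block of age [k > n] would have started before time 0, so nothing is added. *)
have [kn|nk] := leqP k n; last first.
  rewrite (_ : V k.+1 = V k)//; apply/seteqP; split=> w [r|[i ik [i_n a]]]; try by left.
    by right; exists i => //; exact: leq_ltn_trans nk.
  by right; exists i => //; exact: ltnW.
have VS : V k.+1 = V k `|` attempt (n - k).
  apply/seteqP; split=> w.
    case=> [r|[i + [i_n a]]]; first by left; left.
    by rewrite ltnS leq_eqVlt => /predU1P[<-|ik]; [right|left; right; exists i].
  case=> [[r|[i ik [i_n a]]]|a]; first by left.
    by right; exists i => //; exact: ltnW.
  by right; exists k.
have dis : V k `&` attempt (n - k) = set0.
  apply/seteqP; split=> // w [[[_ r]|[i ik [i_n [_ e]]]] [_ e']].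
    exact: (running_notin_block m_gt0 km kn r e').
  have /(congr1 (subn n)) : (n - i = n - k)%N.
    apply: (entry_uniq m_gt0 e e' (leq_subr _ _) _ (leq_subr _ _)).
      by rewrite addnBAC// ltn_subRL addnC ltn_add2l (ltn_trans ik).
    by rewrite addnBAC// ltn_subRL addnC ltn_add2l.
  by rewrite !subKn// => iek; move: ik; rewrite iek ltnn.
rewrite VS; split; first exact: measurableU.
rewrite setIUl measureU//; last 3 first.
- by apply: measurableI => //; exact: m_state.
- by apply: measurableI => //; exact: m_state.
- by rewrite setIACA dis set0I.
rewrite ge0_integral_setU//; last 2 first.
- by apply: measurable_funTS; exact: mPX.
- by rewrite disj_set2E dis.
congr (_ + _); first exact: VE.
by have := attempt_step (n - k) km mA; rewrite subnK.
Qed.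

(** The product formula of [attempt_success] at time [n - m]; its case [A = setT] identifies the
    scalar factor as the mass of [stopped_at n]. *)
Lemma stopped_law n A : measurable A ->
  mu (stopped_at n `&` X n @^-1` A) = phi A * mu (stopped_at n).
Proof.
move=> mA; have [nm|mn] := ltnP n m.
  by rewrite stopped_at_lt// set0I measure0 mule0.
rewrite -(subnK mn) stopped_at_attempt// attempt_success//.
have := attempt_success (n - m) measurableT.
rewrite preimage_setT setIT probability_setT mule1 => ->.
by rewrite muleCA muleA.
Qed.

Lemma alive_balance n A : measurable A ->
  \int[mu]_(w in alive n) P (X n w) A =
  mu (alive n.+1 `&` X n.+1 @^-1` A) + phi A * mu (stopped_at n.+1).
Proof.
move=> mA; rewrite -alive_step// aliveS_stopped setIUl -stopped_law//; apply: measureU.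
- by apply: measurableI => //; exact: m_state.
- by apply: measurableI => //; exact: m_state.
- by rewrite setIACA alive_stopped_disj set0I.
Qed.

Lemma sum_stopped_le1 (c N : nat) : \sum_(n < N) mu (stopped_at (n + c)) <= 1.
Proof.
have tr : trivIset setT (fun n => stopped_at (n + c)).
  have /trivIsetP tr : trivIset setT stopped_at by exact: trivIset_stopped_at.
  by apply/trivIsetP => i j _ _ ij; apply: tr => //; rewrite eqn_add2r.
apply: (@le_trans _ _ (mu (\big[setU/set0]_(n < N) stopped_at (n + c)))).
  by rewrite (measure_bigsetU mu (F := fun n => stopped_at (n + c))).
rewrite -mu1; apply: le_measure; rewrite ?inE//.
by apply: bigsetU_measurable => i _.
Qed.

(** Attempts are thereby counted through the disjoint events {tau = n + m}, without a geometric
    series. *)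
Lemma attempt_stopped n : mu (attempt n) = (lam^-1)%:E * mu (stopped_at (n + m)).
Proof.
rewrite stopped_at_attempt//; have := attempt_success n measurableT.
rewrite preimage_setT setIT probability_setT mule1 => ->.
by rewrite muleA -EFinM mulVf ?mul1e// gt_eqF.
Qed.

(** A visit to [C] at time [n] has some age [i < m], and the attempt at [n - i] has mass lam^-1
    P(tau = n + (m - i)). For fixed [i] these masses sum over [n] to at most 1/lam; there are [m]
    ages. *)
Lemma sum_alive_C N :
  \sum_(n < N) mu (alive n `&` X n @^-1` C) <= (m%:R / lam)%:E.
Proof.
have il0 : (0 <= lam^-1)%R by rewrite invr_ge0 ltW.
pose F n i := if (i <= n)%N then attempt (n - i) else set0.
have mF n i : measurable (F n i) by rewrite /F; case: ifP.
have aF n : mu (alive n `&` X n @^-1` C) <=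
    \sum_(i < m) (lam^-1)%:E * mu (stopped_at (n + (m - i))).
  apply: (@le_trans _ _ (\sum_(i < m) mu (F n i))).
    apply: (@le_trans _ _ (mu (\big[setU/set0]_(i < m) F n i))).
      apply: le_measure; rewrite ?inE.
      - by apply: measurableI => //; exact: m_state.
      - by apply: bigsetU_measurable.
      - move=> w []; rewrite alive_attempt// => -[[_ /(runningP _ m_gt0)[nC _]] /nC//|].
        move=> [i im [i_n a]] _; rewrite -bigcup_mkord; exists i => //.
        by rewrite /F i_n.
    exact: Boole_inequality.
  apply: lee_sum => i _; rewrite /F; case: ifPn => [i_n|_].
    by rewrite attempt_stopped addnBA ?(ltnW (ltn_ord i))// -addnBAC.
  by rewrite measure0 mule_ge0// lee_fin.
apply: (@le_trans _ _ (\sum_(n < N) \sum_(i < m) (lam^-1)%:E * mu (stopped_at (n + (m - i))))).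
  by apply: lee_sum.
rewrite exchange_big /=.
apply: (@le_trans _ _ (\sum_(i < m) (lam^-1)%:E)).
  apply: lee_sum => i _; rewrite -ge0_sume_distrr//.
  by rewrite -[leRHS]mule1 lee_wpmul2l ?lee_fin// sum_stopped_le1.
by rewrite sumEFin sumr_const card_ord lee_fin mulr_natl lexx.
Qed.

Lemma integral_initial (k : S -> \bar R) :
  measurable_fun setT k -> (forall y, 0 <= k y) -> \int[mu]_w k (X 0%N w) = k x.
Proof.
move=> mk k0.
rewrite (@integral_conditional_law _ _ _ _ _ mu _ _ measurableT (mX 0%N) (fun=> \d_x))//.
- under eq_integral do rewrite integral_dirac// diracT mul1e.
  by rewrite integral_cst// mu1 mule1.
- move=> A mA; rewrite setTI (split_init law)//.
  by rewrite integral_cst// mu1 mule1.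
Qed.

Lemma integral_alive_step n (k : S -> \bar R) :
  measurable_fun setT k -> (forall y, 0 <= k y) ->
  \int[mu]_(w in alive n) k (X n.+1 w) =
  \int[mu]_(w in alive n) \int[P (X n w)]_y k y.
Proof.
move=> mk k0.
apply: (@integral_conditional_law _ _ _ _ _ mu _ _ (m_alive n) (mX n.+1)
  (fun w => P (X n w))) => // A mA; first exact: mPX.
exact: alive_step.
Qed.

(** Telescoping of E[v(X_n); n < tau]: shrinking [alive n] to [alive n.+1] only discards a
    nonnegative amount of [v]. The visits to [C] are paid for by [sum_alive_C]. *)
Lemma sum_alive_drift (f v : S -> R) (b : R) N :
  measurable_fun setT f -> (forall y, 0 <= f y)%R ->
  measurable_fun setT v -> (forall y, 0 <= v y)%R -> (0 <= b)%R ->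
  (forall y, \int[P y]_z (v z)%:E <= (v y - f y + b * \1_C y)%:E) ->
  \sum_(n < N) \int[mu]_(w in alive n) (f (X n w))%:E <= (v x + b * m%:R / lam)%:E.
Proof.
move=> mf f0 mv v0 b0 drift.
have mhX n h : measurable_fun setT h ->
    measurable_fun (alive n) (fun w => (h (X n w))%:E : \bar R).
  move=> mh; apply: measurable_funTS; apply/measurable_EFinP.
  exact: measurableT_comp mh (mX n).
have mPv n : measurable_fun (alive n) (fun w => \int[P (X n w)]_z (v z)%:E).
  apply: measurable_funTS.
  apply: (@measurableT_comp _ _ _ _ _ _ (fun y => \int[P y]_z (v z)%:E)) => //.
  apply: measurable_fun_integral_kernel; first exact: measurable_kernel.
    by move=> z; rewrite lee_fin.
  exact/measurable_EFinP.
have bC0 y : (0 <= b * \1_C y)%R by rewrite mulr_ge0// indicE.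
have mbC : measurable_fun setT (fun y => b * \1_C y)%R.
  by apply: measurable_funM => //; exact: measurable_indic.
have step n : \int[mu]_(w in alive n) (f (X n w))%:E +
    \int[mu]_(w in alive n.+1) (v (X n.+1 w))%:E <=
    \int[mu]_(w in alive n) (v (X n w))%:E + b%:E * mu (alive n `&` X n @^-1` C).
  apply: (@le_trans _ _ (\int[mu]_(w in alive n) (f (X n w))%:E +
      \int[mu]_(w in alive n) \int[P (X n w)]_z (v z)%:E)).
    apply: leeD2l; rewrite -(@integral_alive_step n (EFin \o v))//; last first.
      exact/measurable_EFinP.
    apply: ge0_subset_integral => //.
    - apply: measurable_funTS; apply/measurable_EFinP; exact: measurableT_comp mv (mX _).
    - by move=> w _; rewrite lee_fin.
    - by rewrite [X in _ `<=` X]aliveS_stopped; exact: subsetUl.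
  have -> : b%:E * mu (alive n `&` X n @^-1` C) =
      \int[mu]_(w in alive n) (b * \1_C (X n w))%:E.
    under eq_integral do rewrite EFinM.
    rewrite ge0_integralZl_EFin//; last first.
      apply: measurable_funTS; apply/measurable_EFinP.
      by apply: measurableT_comp (mX n); exact: measurable_indic.
    congr (_ * _); rewrite setIC -integral_indic//; last exact: m_state.
  have ge0 h w : (forall y, 0 <= h y)%R -> alive n w -> 0 <= (h (X n w))%:E.
    by move=> h0 _; rewrite lee_fin.
  have Pv0 w : alive n w -> 0 <= \int[P (X n w)]_z (v z)%:E.
    by move=> _; apply: integral_ge0 => z _; rewrite lee_fin.
  rewrite -(ge0_integralD _ (m_alive n) _ (mhX n _ mf) Pv0 (mPv n)); last by move=> w; exact: ge0.
  rewrite -(ge0_integralD _ (m_alive n) _ (mhX n _ mv) _ (mhX n _ mbC)); last 2 first.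
  - by move=> w; exact: ge0.
  - by move=> w _; rewrite lee_fin; exact: bC0.
  apply: ge0_le_integral => //.
  - by move=> w _; rewrite adde_ge0 ?lee_fin// integral_ge0// => z _; rewrite lee_fin.
  - exact: emeasurable_funD (mhX n _ mf) (mPv n).
  - exact: emeasurable_funD (mhX n _ mv) (mhX n _ mbC).
  move=> w _; apply: (le_trans (leeD2l _ (drift (X n w)))).
  by rewrite -!EFinD lee_fin; lra.
have H : \sum_(n < N) \int[mu]_(w in alive n) (f (X n w))%:E +
    \int[mu]_(w in alive N) (v (X N w))%:E <=
    (v x)%:E + b%:E * \sum_(n < N) mu (alive n `&` X n @^-1` C).
  elim: N => [|N IH].
    rewrite !big_ord0 mule0 adde0 add0e alive0//.
    by rewrite (@integral_initial (EFin \o v)) ?lee_fin//; exact/measurable_EFinP.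
  rewrite !big_ord_recr /= -addeA; apply: (le_trans (leeD2l _ (step N))).
  rewrite addeA ge0_muleDr//; last by apply: sume_ge0.
  by rewrite [leRHS]addeA; exact: leeD.
apply: (@le_trans _ _ ((v x)%:E + b%:E * \sum_(n < N) mu (alive n `&` X n @^-1` C))).
  apply: le_trans H; apply: leeDl; apply: integral_ge0 => w _; by rewrite lee_fin.
rewrite EFinD -mulrA EFinM; apply: leeD2l; apply: lee_wpmul2l; rewrite ?lee_fin//.
exact: sum_alive_C.
Qed.

(** * Occupation measure, its balance equation and finiteness of tau *)

Definition occ_at n : {measure set S -> \bar R} :=
  law_on mu (m_alive n) (mX n).
Definition occupation : {measure set S -> \bar R} := mseries occ_at 0.

Lemma occupationE A : occupation A = \sum_(0 <= n <oo) mu (alive n `&` X n @^-1` A).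
Proof. by apply: eq_eseriesr => n _; exact: law_onE. Qed.

Lemma integral_occupation (k : S -> \bar R) :
  measurable_fun setT k -> (forall y, 0 <= k y) ->
  \int[occupation]_y k y = \sum_(0 <= n <oo) \int[mu]_(w in alive n) k (X n w).
Proof.
move=> mk k0; rewrite ge0_integral_measure_series//.
by apply: eq_eseriesr => n _; rewrite integral_law_on.
Qed.

(** Applied to [f] with [v1], and to the constant 1 with [v2]; the second use supplies the
    finiteness assumed below as [occ_fin]. *)
Lemma occupation_drift (f v : S -> R) (b : R) :
  measurable_fun setT f -> (forall y, 0 <= f y)%R ->
  measurable_fun setT v -> (forall y, 0 <= v y)%R -> (0 <= b)%R ->
  (forall y, \int[P y]_z (v z)%:E <= (v y - f y + b * \1_C y)%:E) ->
  \int[occupation]_y (f y)%:E <= (v x + b * m%:R / lam)%:E.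
Proof.
move=> mf f0 mv v0 b0 drift.
rewrite (@integral_occupation (EFin \o f))//; last exact/measurable_EFinP.
apply: lime_le.
  by apply: is_cvg_nneseries => n _ _; apply: integral_ge0 => w _; rewrite lee_fin.
by apply: nearW => N; rewrite big_mkord; exact: sum_alive_drift drift.
Qed.

Hypothesis occ_fin : occupation setT < +oo.

(** Sum of [alive_balance] over [n]. The occupation terms on its right start at time 1; the missing
    term at time 0 is [\d_x]. The series on the right is P(tau < oo), not yet known to be 1. *)
Let balance A : measurable A ->
  \d_x A + \int[occupation]_y P y A =
  occupation A + phi A * \sum_(0 <= n <oo) mu (stopped_at n.+1).
Proof.
move=> mA; rewrite (@integral_occupation (fun y => P y A))//; last exact: measurable_kernel.
have -> : \sum_(0 <= n <oo) \int[mu]_(w in alive n) P (X n w) A = \sum_(0 <= n <oo)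
    (mu (alive n.+1 `&` X n.+1 @^-1` A) + phi A * mu (stopped_at n.+1)).
  by apply: eq_eseriesr => n _; exact: alive_balance.
rewrite nneseriesD; [|by move=> *; exact: measure_ge0|by move=> *; exact: mule_ge0].
rewrite addeA; congr (_ + _); last first.
  rewrite -[phi A]fineK ?fin_num_measure//.
  by rewrite nneseriesZl.
rewrite occupationE [RHS]nneseries_recl//; congr (_ + _).
  by rewrite alive0// setTI (split_init law).
by rewrite -(@nneseries_addn _ _ 1%N)//; under [RHS]eq_eseriesr do rewrite addn1.
Qed.

(** Total masses in [balance]: the finite mass of [occupation] appears on both sides and cancels. *)
Lemma sum_stopped : \sum_(0 <= n <oo) mu (stopped_at n.+1) = 1.
Proof.
have := balance measurableT.
rewrite diracT integral_kernel_setT probability_setT mul1e addeC.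
have: occupation setT \is a fin_num by rewrite ge0_fin_numE.
move: (occupation setT) => [r||]// _.
case: (\sum_(0 <= n <oo) mu (stopped_at n.+1)) => [s||]// [/addrI H].
by congr EFin.
Qed.

Lemma occupation_balance A : measurable A ->
  \d_x A + \int[occupation]_y P y A = occupation A + phi A.
Proof. by move=> mA; rewrite balance// sum_stopped mule1. Qed.

Let stopped := \bigcup_n stopped_at n.+1.

Let m_stopped_some : measurable stopped.
Proof. by apply: bigcupT_measurable => n. Qed.

Let stoppedP w : stopped w <-> split_tau C m (trajectory X w) (coins B w) <> None.
Proof.
split=> [[n _ ->]//|]; case E : split_tau => [[|n]|] // _; last by exists n.
by have : stopped_at 0%N w by []; rewrite stopped_at_lt.
Qed.

Let not_stopped_null : mu (~` stopped) = 0.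
Proof.
have stopped1 : mu stopped = 1.
  rewrite /stopped measure_semi_bigcup//; first exact: sum_stopped.
  have /trivIsetP tr : trivIset setT stopped_at by exact: trivIset_stopped_at.
  by apply/trivIsetP => i j _ _ ij; apply: tr.
have : mu stopped + mu (~` stopped) = 1.
  rewrite -mu1 -(setUCr stopped); apply/esym/measureU => //; last by rewrite setICr.
  exact: measurableC.
rewrite stopped1; case: (mu (~` stopped)) => [r||]// [].
by rewrite -[RHS]addr0 => /addrI ->.
Qed.

Lemma split_tau_finite_ae :
  {ae mu, forall w, split_tau C m (trajectory X w) (coins B w) <> None}.
Proof.
exists (~` stopped); split=> //; first exact: measurableC.
by move=> w /= nfin /stoppedP.
Qed.

(** * Cycle sums as integrals against the occupation measure *)

Local Notation cycle h w := (cycle_sum h C m (trajectory X w) (coins B w)).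

(** The indicator of [stopped] encodes the convention 0 for infinite tau, where the series itself
    may be positive or infinite. *)
Let cycle_sumE (h : S -> R) w : (forall y, 0 <= h y)%R ->
  (cycle h w)%:E =
  (\sum_(0 <= n <oo) (h (X n w))%:E * (\1_(alive n) w)%:E) * (\1_stopped w)%:E.
Proof.
move=> h0; rewrite /cycle_sum; case E : split_tau => [t|]; last first.
  by rewrite indicE memNset ?mule0//= => /stoppedP.
rewrite [\1_stopped w]indicE mem_set/= ?mule1; last by apply/stoppedP; rewrite E.
have aliveE n : (\1_(alive n) w : R) = (n < t)%N%:R.
  rewrite indicE; have -> // : (w \in alive n) = (n < t)%N.
  by apply/idP/idP; rewrite inE /alive /= E.
rewrite (nneseries_split _ t); last by move=> n _; rewrite mule_ge0// lee_fin.
rewrite add0n [X in _ + X]eseries0 ?adde0; last first.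
  by move=> n tn _; rewrite aliveE ltnNge tn mule0.
rewrite big_mkord -sumEFin; apply: eq_bigr => n _.
by rewrite aliveE ltn_ord mule1.
Qed.

Let m_series (h : S -> R) : measurable_fun setT h -> (forall y, 0 <= h y)%R ->
  measurable_fun setT (fun w => \sum_(0 <= n <oo) (h (X n w))%:E * (\1_(alive n) w)%:E).
Proof.
move=> mh h0; apply: ge0_emeasurable_sum => [n w _ _|n _].
  by rewrite mule_ge0// lee_fin.
apply: emeasurable_funM; apply/measurable_EFinP.
  exact: measurableT_comp mh (mX n).
exact: measurable_indic.
Qed.

Lemma measurable_cycle_sum (h : S -> R) :
  measurable_fun setT h -> (forall y, 0 <= h y)%R ->
  measurable_fun setT (fun w => cycle h w).
Proof.
move=> mh h0; apply/measurable_EFinP.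
rewrite (_ : _ \o _ = fun w => (\sum_(0 <= n <oo) (h (X n w))%:E * (\1_(alive n) w)%:E) *
  (\1_stopped w)%:E); last by apply/funext => w; exact: cycle_sumE.
apply: emeasurable_funM; first exact: m_series.
by apply/measurable_EFinP; exact: measurable_indic.
Qed.

Lemma integral_cycle_sum (h : S -> R) :
  measurable_fun setT h -> (forall y, 0 <= h y)%R ->
  \int[mu]_w (cycle h w)%:E = \int[occupation]_y (h y)%:E.
Proof.
move=> mh h0; have mEh : measurable_fun setT (EFin \o h) by exact/measurable_EFinP.
rewrite (@integral_occupation (EFin \o h))//.
rewrite (ae_eq_integral
  (fun w => \sum_(0 <= n <oo) (h (X n w))%:E * (\1_(alive n) w)%:E))//; last 3 first.
- by apply/measurable_EFinP; exact: measurable_cycle_sum.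
- exact: m_series.
- exists (~` stopped); split=> //; first exact: measurableC.
  move=> w /=; apply: contra_not => sw _.
  have sw1 : \1_stopped w = 1%R :> R by rewrite indicE mem_set.
  by rewrite cycle_sumE// sw1 mule1.
rewrite integral_nneseries//; last 2 first.
- move=> n; apply: emeasurable_funM; apply/measurable_EFinP.
    exact: measurableT_comp mh (mX n).
  exact: measurable_indic.
- by move=> n w _; rewrite mule_ge0// lee_fin.
apply: eq_eseriesr => n _; rewrite [RHS]integral_mkcond.
by apply: eq_integral => w _; rewrite epatch_indic.
Qed.

End split_law_consequences.

(** * The measure P(x, .) K and its comparison with K x *)

Section mixture_measure.
Context d d' (T : measurableType d) (S : measurableType d') (R : realType).
Variables (rho : {measure set T -> \bar R}) (K : T -> {measure set S -> \bar R}).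
Local Open Scope ereal_scope.

Lemma mixture_measure_exists :
  (forall A, measurable A -> measurable_fun [set: T] (fun t => K t A : \bar R)) ->
  exists nu : {measure set S -> \bar R},
    forall A, measurable A -> nu A = \int[rho]_t K t A.
Proof.
move=> mK; pose nu A := \int[rho]_t K t A.
have nu0 : nu set0 = 0 by apply: integral0_eq => t _; rewrite measure0.
have nu_ge0 A : 0 <= nu A by exact: integral_ge0.
have nu_sigma_additive : semi_sigma_additive nu.
  move=> U mU tU mUU; rewrite [X in _ --> X](_ : _ =
    \int[rho]_t (\sum_(n <oo) K t (U n))); last first.
    apply: eq_integral => t _.
    by apply/esym/cvg_lim => //; exact/measure_semi_sigma_additive.
  apply/cvg_closeP; split.
    by apply: is_cvg_nneseries => n _ _; exact: integral_ge0.
  by rewrite closeE// integral_nneseries// => n; exact: mK.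
pose nu_mix := isMeasure.Build _ _ _ nu nu0 nu_ge0 nu_sigma_additive.
pose nu_pack : {measure set S -> \bar R} := HB.pack nu nu_mix.
by exists nu_pack.
Qed.

End mixture_measure.

(** Makes [1 - lam], the weight of the residual kernel, nonnegative. *)
Lemma minorization_le1 d (S : measurableType d) (R : realType) (P : R.-pker S ~> S)
    (phi : probability S R) (m : nat) (lam : R) (x : S) :
  (lam%:E * phi setT <= kernel_iter P m x setT)%E -> lam <= 1.
Proof. by rewrite probability_setT mule1 kernel_iter_setT lee_fin. Qed.

Section shifted_occupation.
Context d (S : measurableType d) (R : realType) (P : R.-pker S ~> S).
Variables (pi phi : probability S R) (K : S -> {measure set S -> \bar R}).
Local Open Scope ereal_scope.
Hypothesis pi_unique : forall mu : probability S R, stationary P mu ->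
  forall A, measurable A -> mu A = pi A.
Hypothesis mK : forall A, measurable A ->
  measurable_fun [set: S] (fun y => K y A : \bar R).
Hypothesis K_fin : forall x, K x setT < +oo.
Hypothesis PK_fin : forall x, \int[P x]_y K y setT < +oo.
Hypothesis K_balance : forall x A, measurable A ->
  \d_x A + \int[K x]_y P y A = K x A + phi A.

(* [K x] and [\d_x + P x K] have the same defect of invariance [\d_x - phi]. *)
Lemma occupation_shift x : exists c c' : {nonneg R}, forall h : S -> R,
  measurable_fun setT h -> (forall y, 0 <= h y)%R ->
  \int[K x]_y (h y)%:E + c%:num%:E * \int[pi]_y (h y)%:E =
  (h x)%:E + \int[P x]_y \int[K y]_z (h z)%:E + c'%:num%:E * \int[pi]_y (h y)%:E.
Proof.
have [nu nuE] := mixture_measure_exists (P x) mK.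
pose beta := measure_add \d_x nu.
have betaE A : beta A = \d_x A + nu A by exact: measure_addE.
have beta_fin : beta setT < +oo.
  by rewrite betaE nuE// diracT lte_add_pinfty// ltry.
have int_nu (k : S -> \bar R) : measurable_fun setT k -> (forall y, 0 <= k y) ->
    \int[nu]_y k y = \int[P x]_y \int[K y]_z k z.
  by move=> mk k0; exact: ge0_integral_mixture.
have int_beta (k : S -> \bar R) : measurable_fun setT k -> (forall y, 0 <= k y) ->
    \int[beta]_y k y = k x + \int[P x]_y \int[K y]_z k z.
  move=> mk k0; rewrite ge0_integral_measure_add// int_nu//.
  by rewrite integral_dirac// diracT mul1e.
(* Applying P to beta gives P(x, .) + P(x, .) K P; integrating [K_balance] under P(x, .) turns this
   into nu + phi. *)
have inv A : measurable A -> K x A + \int[beta]_y P y A = beta A + \int[K x]_y P y A.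
  move=> mA; have mPA := measurable_kernel P A mA.
  rewrite int_beta// betaE nuE// [RHS]addeAC K_balance// -addeA; congr (_ + _).
  transitivity (\int[P x]_y (\d_y A + \int[K y]_z P z A)).
    rewrite [RHS]ge0_integralD//.
    - by congr (_ + _); exact/esym/kernel_iter1.
    - rewrite (_ : (fun y => _) = EFin \o \1_A); last first.
        by apply/funext => y /=; rewrite diracE indicE.
      by apply/measurable_EFinP; exact: measurable_indic.
    - by move=> y _; exact: integral_ge0.
    - exact: measurable_fun_integral_kernel.
  under eq_integral do rewrite K_balance//.
  rewrite [LHS]ge0_integralD//; last exact: mK.
  by rewrite integral_cst// prob_kernel mule1 addeC.
have [c [c' cE]] := invariant_difference pi_unique (K_fin x) beta_fin inv.
exists c, c' => h mh h0.
have mEh : measurable_fun setT (EFin \o h) by exact/measurable_EFinP.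
have h0' y : 0 <= (EFin \o h) y by rewrite lee_fin.
have h0T y : setT y -> 0 <= (EFin \o h) y by [].
rewrite -(int_beta (EFin \o h))//.
rewrite -(ge0_integral_mscale pi measurableT c mEh h0T).
rewrite -(ge0_integral_mscale pi measurableT c' mEh h0T).
rewrite -!ge0_integral_measure_add//.
apply: eq_measure_integral => A mA _.
transitivity (K x A + c%:num%:E * pi A); first exact: measure_addE.
by rewrite cE//; exact/esym/measure_addE.
Qed.

End shifted_occupation.

(** * Integrability and the final assembly *)

Lemma ge0_integrable d (T : measurableType d) (R : realType)
    (mu : {measure set T -> \bar R}) (h : T -> R) :
  measurable_fun setT h -> (forall w, 0 <= h w) ->
  (\int[mu]_w (h w)%:E < +oo)%E -> mu.-integrable setT (EFin \o h).
Proof.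
move=> mh h0 hoo; apply/integrableP; split; first exact/measurable_EFinP.
by under eq_integral do rewrite /= ger0_norm//.
Qed.

Lemma drift_integrable d (S : measurableType d) (R : realType)
    (P : R.-pker S ~> S) (v : S -> R) (k : R) (x : S) (h : S -> R) (a : R) :
  measurable_fun setT h -> (forall y, 0 <= h y) ->
  measurable_fun setT v -> (forall y, 0 <= v y) -> 0 <= a ->
  (\int[P x]_y (v y)%:E <= k%:E)%E -> (forall y, h y <= v y + a) ->
  (P x).-integrable setT (EFin \o h).
Proof.
move=> mh h0 mv v0 a0 vk hv; apply: ge0_integrable => //.
apply: (@le_lt_trans _ _ (\int[P x]_y ((v y)%:E + a%:E))%E).
  apply: ge0_le_integral => //.
  - by move=> y _; rewrite lee_fin.
  - exact/measurable_EFinP.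
  - by apply: emeasurable_funD => //; exact/measurable_EFinP.
  - by move=> y _; rewrite -EFinD lee_fin.
rewrite ge0_integralD//; last 2 first.
- by move=> y _; rewrite lee_fin.
- exact/measurable_EFinP.
rewrite integral_cst// prob_kernel mule1.
by apply: lte_add_pinfty (ltry _); exact: le_lt_trans vk (ltry _).
Qed.

Theorem theorem2p2 (R : realType) (d : measure_display) (S : measurableType d)
    (P : R.-pker S ~> S) (pi : probability S R)
    (pi_stationary : stationary P pi)
    (pi_unique : forall mu : probability S R, stationary P mu ->
       forall A, measurable A -> mu A = pi A)
    (f v1 v2 : S -> R) (C : set S) (phi : probability S R)
    (m : nat) (lam b1 b2 : R)
    (f_meas : measurable_fun setT f) (f_ge0 : forall x, 0 <= f x)
    (v1_meas : measurable_fun setT v1) (v1_ge0 : forall x, 0 <= v1 x)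
    (v2_meas : measurable_fun setT v2) (v2_ge0 : forall x, 0 <= v2 x)
    (C_meas : measurable C) (C_neq0 : C !=set0)
    (m_ge1 : (1 <= m)%N)
    (lam_gt0 : 0 < lam) (b1_gt0 : 0 < b1) (b2_gt0 : 0 < b2)
    (drift1 : forall x,
       (\int[P x]_y (v1 y)%:E <= (v1 x - f x + b1 * \1_C x)%:E)%E)
    (drift2 : forall x,
       (\int[P x]_y (v2 y)%:E <= (v2 x - 1 + b2 * \1_C x)%:E)%E)
    (minorization : forall x A, C x -> measurable A ->
       (lam%:E * phi A <= kernel_iter P m x A)%E)
    (Q : R.-pker S ~> S) (Q_residual : residual_kernel P C m lam phi Q)
    (Br : R.-pker (S * S) ~> (m.-1.-tuple S)) (Br_bridge : bridge_kernel P C Br)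
    (d' : measure_display) (Omega : measurableType d')
    (Pr : R.-pker S ~> Omega)
    (X : nat -> Omega -> S) (B : nat -> Omega -> bool)
    (X_meas : forall n, measurable_fun setT (X n))
    (B_meas : forall n, measurable_fun setT (B n))
    (XB_split : forall x, split_law P C lam phi Q Br X B x (Pr x)) :
  let fc x := f x - \int[pi]_y f y in
  let tau w := split_tau C m (trajectory X w) (coins B w) in
  let Z w := cycle_sum fc C m (trajectory X w) (coins B w) in
  let gstar x := \int[Pr x]_w Z w in
  (* f_c and g* are well defined *)
  [/\ pi.-integrable setT (EFin \o f),
      (forall x, {ae Pr x, forall w, tau w <> None})
    & (forall x, (Pr x).-integrable setT (EFin \o Z))] /\
  [/\ poisson_solution P fc gstar,
      (forall x, - b1 * (v2 x + b2 * m%:R / lam) <= gstar x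
                 <= v1 x + b1 * m%:R / lam)
    & (forall x, `|gstar x| <= Num.max (v1 x + b1 * m%:R / lam)
                                      (b1 * (v2 x + b2 * m%:R / lam)))].
Proof.
move=> fc tau Z gstar.
have [x0 Cx0] := C_neq0.
have lam_le1 : lam <= 1 := minorization_le1 (minorization _ _ Cx0 measurableT).
have mEf : measurable_fun setT (EFin \o f) by exact/measurable_EFinP.
have m1 : measurable_fun setT (cst 1 : S -> R) by exact: measurable_cst.
have b10 := ltW b1_gt0; have b20 := ltW b2_gt0.
pose occ x := occupation m_ge1 C_meas X_meas B_meas (Pr x).
have Pr1 x : Pr x setT = 1%E by exact: prob_kernel.
pose k1 : R := b1 * m%:R / lam; pose k2 : R := b2 * m%:R / lam.
have k10 : 0 <= k1 by rewrite /k1 divr_ge0 ?mulr_ge0 ?ler0n ?ltW.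
have k20 : 0 <= k2 by rewrite /k2 divr_ge0 ?mulr_ge0 ?ler0n ?ltW.
have occF x : (\int[occ x]_y (f y)%:E <= (v1 x + k1)%:E)%E.
  exact: (occupation_drift _ _ _ _ lam_gt0 lam_le1 Q_residual Br_bridge (Pr1 x) (XB_split x)).
have occ1E x : (\int[occ x]_y (cst 1 y : R)%:E)%E = occ x setT.
  by rewrite -[RHS]mul1e; exact: (integral_cst (occ x) measurableT 1%E).
have pi1E : (\int[pi]_y (cst 1 y : R)%:E)%E = 1%E.
  apply: etrans (integral_cst pi measurableT 1%E) _.
  by rewrite mul1e; exact: probability_setT.
have occ1 x : (occ x setT <= (v2 x + k2)%:E)%E.
  rewrite -occ1E.
  exact: (occupation_drift _ _ _ _ lam_gt0 lam_le1 Q_residual Br_bridge (Pr1 x) (XB_split x)).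
have occ_fin x : (occ x setT < +oo)%E by exact: le_lt_trans (occ1 x) (ltry _).
(* The indicator of [C] is bounded by 1. This estimate is the source of the factor [b1] in the lower
   bound for [gstar]. *)
have pif_le : (\int[pi]_y (f y)%:E <= b1%:E)%E.
  apply: (stationary_drift_bound (v := v1) pi_stationary) => // x.
  apply: (le_trans (drift1 x)); rewrite lee_fin lerD2l.
  by rewrite ler_piMr// indicE lern1 leq_b1.
have pif_ge0 : (0 <= \int[pi]_y (f y)%:E)%E by apply: integral_ge0 => y _; rewrite lee_fin.
have pif_int : pi.-integrable setT (EFin \o f).
  by apply: ge0_integrable => //; exact: le_lt_trans pif_le (ltry _).
pose c := \int[pi]_y f y.
have cE : (\int[pi]_y (f y)%:E)%E = c%:E.
  by rewrite /c /Rintegral fineK// ge0_fin_numE// (le_lt_trans pif_le)// ltry.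
have c_ge0 : 0 <= c by rewrite -lee_fin -cE.
have c_le : c <= b1 by rewrite -lee_fin -cE.
have tau_fin x : {ae Pr x, forall w, tau w <> None}.
  exact: (split_tau_finite_ae lam_gt0 lam_le1 Q_residual Br_bridge (Pr1 x) (XB_split x) (occ_fin x)).
pose Zh (h : S -> R) w := cycle_sum h C m (trajectory X w) (coins B w).
have ZE w : Z w = Zh f w - c * Zh (cst 1) w.
  rewrite /Z /Zh /cycle_sum; case: split_tau => [t|]; last by rewrite mulr0 subr0.
  by rewrite mulr_sumr -sumrB; apply: eq_bigr => i _; rewrite mulr1.
have Zh_int x (h : S -> R) : measurable_fun setT h -> (forall y, 0 <= h y) ->
    (\int[Pr x]_w (Zh h w)%:E)%E = (\int[occ x]_y (h y)%:E)%E.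
  exact: (integral_cycle_sum lam_gt0 lam_le1 Q_residual Br_bridge (Pr1 x) (XB_split x) (occ_fin x)).
have Zh_ge0 (h : S -> R) w : (forall y, 0 <= h y) -> 0 <= Zh h w.
  by move=> h0; rewrite /Zh /cycle_sum; case: split_tau => // t; exact: sumr_ge0.
have Zh_meas (h : S -> R) : measurable_fun setT h -> (forall y, 0 <= h y) -> measurable_fun setT (Zh h).
  by move=> mh h0; exact: (measurable_cycle_sum m_ge1 C_meas X_meas B_meas).
have Zf_int x : (Pr x).-integrable setT (EFin \o Zh f).
  apply: ge0_integrable; [exact: Zh_meas|by move=> w; exact: Zh_ge0|].
  by rewrite Zh_int//; exact: le_lt_trans (occF x) (ltry _).
have Z1_int x : (Pr x).-integrable setT (EFin \o Zh (cst 1)).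
  apply: ge0_integrable; [exact: Zh_meas|by move=> w; exact: Zh_ge0|].
  by rewrite Zh_int// occ1E.
have cZ1_int x : (Pr x).-integrable setT (EFin \o (fun w => c * Zh (cst 1) w)).
  exact: integrableZl (measurableT) c _ (Z1_int x).
have Z_int x : (Pr x).-integrable setT (EFin \o Z).
  apply: eq_integrable (integrableB measurableT (Zf_int x) (cZ1_int x)) => // w _.
  by rewrite /= ZE.
pose F x := fine (\int[occ x]_y (f y)%:E)%E; pose T x := fine (occ x setT).
have FE x : (\int[occ x]_y (f y)%:E)%E = (F x)%:E.
  rewrite /F fineK// ge0_fin_numE; first exact: le_lt_trans (occF x) (ltry _).
  by apply: integral_ge0 => y _; rewrite lee_fin.
have TE x : occ x setT = (T x)%:E by rewrite /T fineK// ge0_fin_numE.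
have F_ge0 x : 0 <= F x by rewrite -lee_fin -FE integral_ge0// => y _; rewrite lee_fin.
have T_ge0 x : 0 <= T x by rewrite -lee_fin -TE.
have F_le x : F x <= v1 x + k1 by rewrite -lee_fin -FE.
have T_le x : T x <= v2 x + k2 by rewrite -lee_fin -TE.
have gE x : gstar x = F x - c * T x.
  rewrite /gstar; under eq_Rintegral do rewrite ZE.
  rewrite RintegralB// RintegralZl//.
  by rewrite /Rintegral !Zh_int// occ1E.
(* Each term of the series is the [Pr x]-mass of an event that does not depend on [x], hence
   measurable in [x] because [Pr] is a kernel. *)
have mocc A : measurable A -> measurable_fun [set: S] (fun x => occ x A : \bar R).
  move=> mA; under eq_fun do rewrite /occ occupationE.
  apply: ge0_emeasurable_sum => // n _; apply: measurable_kernel.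
  by apply: measurableI; [exact: measurable_alive|exact: measurable_state].
have mF : measurable_fun setT F.
  apply/measurable_EFinP; rewrite (_ : _ \o _ = fun x => \int[occ x]_y (f y)%:E)%E.
    by apply: measurable_fun_integral_kernel => // y; rewrite lee_fin.
  by apply/funext => x; rewrite FE.
have mT : measurable_fun setT T.
  apply/measurable_EFinP; rewrite (_ : _ \o _ = fun x => occ x setT); first exact: mocc.
  by apply/funext => x; rewrite TE.
have PF_int x : (P x).-integrable setT (EFin \o F).
  exact: drift_integrable mF F_ge0 v1_meas v1_ge0 k10 (drift1 x) F_le.
have PT_int x : (P x).-integrable setT (EFin \o T).
  exact: drift_integrable mT T_ge0 v2_meas v2_ge0 k20 (drift2 x) T_le.
have PcT_int x : (P x).-integrable setT (EFin \o (fun y => c * T y)).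
  exact: integrableZl measurableT c _ (PT_int x).
have PFE x : (\int[P x]_y \int[occ y]_z (f z)%:E)%E = (\int[P x]_y F y)%:E.
  under eq_integral do rewrite FE.
  by rewrite /Rintegral fineK//; exact: integrable_fin_num (PF_int x).
have PTE x : (\int[P x]_y occ y setT)%E = (\int[P x]_y T y)%:E.
  under eq_integral do rewrite TE.
  by rewrite /Rintegral fineK//; exact: integrable_fin_num (PT_int x).
have PT_fin x : (\int[P x]_y occ y setT < +oo)%E by rewrite PTE ltry.
have occ_balance x A : measurable A ->
    (\d_x A + \int[occ x]_y P y A = occ x A + phi A)%E.
  exact: (occupation_balance lam_gt0 lam_le1 Q_residual Br_bridge (XB_split x) (occ_fin x)).
(* The same [a] and [a'] serve for [f] and for 1. Subtracting [c] times the identity for 1 from the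
   identity for [f] eliminates them, since the integral of [f] under [pi] is [c]. *)
have poisson x : \int[P x]_y gstar y - gstar x = - fc x.
  have [a [a' shift]] := occupation_shift pi_unique mocc occ_fin PT_fin occ_balance x.
  have : F x + a%:num * c = f x + \int[P x]_y F y + a'%:num * c.
    by apply: EFin_inj; rewrite !EFinD !EFinM -cE -FE -PFE; exact: shift.
  have : T x + a%:num = 1 + \int[P x]_y T y + a'%:num.
    apply: EFin_inj; rewrite !EFinD -TE -PTE -occ1E.
    have := shift _ m1 (fun=> ler01).
    rewrite pi1E !mule1 => ->.
    by congr (_ + _ + _)%E; apply: eq_integral => y _; rewrite occ1E.
  have -> : \int[P x]_y gstar y = \int[P x]_y (F y - c * T y).
    by apply: eq_Rintegral => y _; exact: gE.
  rewrite RintegralB// RintegralZl// gE /fc -/c => ET EF.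
  by have := congr1 ( *%R c) ET; lra.
(* Each side drops one nonnegative term of F - c T; the lower bound also uses [c <= b1]. *)
have bounds x : - b1 * (v2 x + k2) <= gstar x <= v1 x + k1.
  rewrite gE; apply/andP; split.
    rewrite mulNr; apply: (@le_trans _ _ (- (c * T x))); last by rewrite lerDr.
    by rewrite lerN2 ler_pM.
  by apply: le_trans (F_le x); rewrite gerDl oppr_le0 mulr_ge0.
split; first by [].
split.
- split=> [x|x]; last exact: poisson.
  apply: eq_integrable (integrableB measurableT (PF_int x) (PcT_int x)) => // y _.
  by rewrite /= gE.
- exact: bounds.
- move=> x; have /andP[lo up] := bounds x.
  rewrite ler_norml le_max up andbT lerNl le_max; apply/orP; right.
  by rewrite lerNl -mulNr.
Qed.
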